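(* Consider the combined system $(M,b)$ of $n+1$ consistent linear systems with solutions $x_*^{(0)},\dots,x_*^{(n)}$, satisfying the Uniqueness Assumption, as defined in the context. There is $r'\in(0,1)$ such that if $r\in(0,r')$, then for the MRK algorithm with swap probability $r$ and sampling distribution $\mathcal{D}$ (run indefinitely), each iterate converges almost surely to a different solution of the subsystems; that is, almost surely there is a (random) permutation $\sigma$ of $\{0,1,\dots,n\}$ such that $$\lim_{k\to\infty} x_k^{(i)} = x_*^{(\sigma(i))}\qquad\text{for all } i\in\{0,1,\dots,n\}.$$
   Context: Problem setting. Let $n\in\mathbb{N}$ and $d\ge 1$. For $i\in\{0,1,\dots,n\}$ let $M^{(i)}x_*^{(i)}=b^{(i)}$ be a consistent real linear system in $d$ unknowns with solution $x_*^{(i)}\in\mathbb{R}^d$. Let $M\in\mathbb{R}^{m\times d}$ be the matrix and $b\in\mathbb{R}^m$ the vector obtained by stacking all $M^{(i)}$ and all $b^{(i)}$ respectively (rows possibly shuffled, in the same way for $M$ and $b$). The $\ell$-th row of $M$ is denoted $M_\ell$ (a nonzero row vector) and the corresponding entry of $b$ is $b_\ell$. $\|\cdot\|$ is the Euclidean norm. Uniqueness Assumption. The solution to the set of systems is unique up to relabeling: if $x_0,\dots,x_n\in\mathbb{R}^d$ are such that for every row index $\ell\in\{1,\dots,m\}$ there is an index $i_\ell\in\{0,\dots,n\}$ with $M_\ell x_{i_\ell}=b_\ell$, then there is a permutation $\sigma$ of $\{0,1,\dots,n\}$ with $x_*^{(i)}=x_{\sigma(i)}$ for all $i$. Multi-Randomized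 Kaczmarz (MRK) algorithm with swap probability $r\in[0,1]$ and sampling distribution $\mathcal{D}$, a probability distribution on the row indices $\{1,\dots,m\}$ given as input. Start from initial iterates $x_0^{(0)},\dots,x_0^{(n)}\in\mathbb{R}^d$ given as input. For $k=0,1,2,\dots$: (1) sample a row index $i_k\sim\mathcal{D}$, independently of the past; (2) compute $c_{i,k}=\dfrac{M_{i_k}x_k^{(i)}-b_{i_k}}{\|M_{i_k}\|^2}$ for $i=0,\dots,n$; (3) let $s_k\in\operatorname{argmin}_{i\in\{0,\dots,n\}}|c_{i,k}|$; (4) with probability $1-r$ set $t_k=s_k$, and with the remaining probability $r$ let $t_k$ be uniformly distributed on $\{0,\dots,n\}$ (so each $t\in\{0,\dots,n\}$ is selected in this way with probability $\frac{r}{n+1}$), using fresh independent randomness; (5) set $x_{k+1}^{(t_k)}=x_k^{(t_k)}-|c_{s_k,k}|\operatorname{sgn}(c_{t_k,k})\,M_{i_k}^T$ and $x_{k+1}^{(j)}=x_k^{(j)}$ for $j\ne t_k$.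
   Formalization: The sampling distribution D is assumed to give every row index positive probability; otherwise the claim fails (n=0, d=2, M=I, b=0, D concentrated on row 1: the second coordinate never changes). *)

(* Defs.v *)
From HB Require Import structures.
From mathcomp Require Import all_boot all_order all_algebra all_fingroup.
From mathcomp Require Import all_classical all_reals all_analysis.
Set Implicit Arguments.
Unset Strict Implicit.
Unset Printing Implicit Defensive.
Import Order.TTheory GRing.Theory Num.Theory.
Import numFieldNormedType.Exports.
Local Open Scope classical_set_scope.
Local Open Scope ring_scope.

(* Throughout, n.+1 is the number of systems, d the number of unknowns and m   *)
(* the total number of rows; a family of n.+1 points of R^d is a function      *)
(* 'I_n.+1 -> 'cV[R]_d.                                                        *)

Section Systems.
Context {R : realType} {n d : nat}.

(* The rows of the blocks A 0, ..., A n, stacked and then shuffled by p. *)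
Definition stacked (c : nat) (q : 'I_n.+1 -> nat) (p : 'S_(\sum_i q i))
    (A : forall i, 'M[R]_(q i, c)) : 'M[R]_(\sum_i q i, c) :=
  row_perm p (\mxcol_i A i).

Definition unique_up_to_relabeling (m : nat) (M : 'M[R]_(m, d)) (b : 'cV[R]_m)
    (xstar : 'I_n.+1 -> 'cV[R]_d) : Prop :=
  forall x : 'I_n.+1 -> 'cV[R]_d,
    (forall l : 'I_m, exists i, (row l M *m x i) 0 0 = b l 0) ->
    exists sigma : 'S_n.+1, forall i, xstar i = x (sigma i).

(* Matrices carry the sup norm in the library. *)
Definition euclid_norm (v : 'rV[R]_d) : R := Num.sqrt (\sum_j v 0 j ^+ 2).

End Systems.

Section Algorithm.
Context {R : realType} {n d m : nat}.
Variables (M : 'M[R]_(m, d)) (b : 'cV[R]_m).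

Definition mrk_coef (l : 'I_m) (x : 'cV[R]_d) : R :=
  ((row l M *m x) 0 0 - b l 0) / euclid_norm (row l M) ^+ 2.

Definition is_argmin (l : 'I_m) (x : 'I_n.+1 -> 'cV[R]_d) (s : 'I_n.+1) : Prop :=
  forall i, `|mrk_coef l (x s)| <= `|mrk_coef l (x i)|.

Definition mrk_update (l : 'I_m) (s t : 'I_n.+1) (x : 'I_n.+1 -> 'cV[R]_d) :
    'I_n.+1 -> 'cV[R]_d :=
  fun j => if j == t
    then x t - (`|mrk_coef l (x s)| * Num.sg (mrk_coef l (x t))) *: (row l M)^T
    else x j.

Fixpoint mrk_iterates (x0 : 'I_n.+1 -> 'cV[R]_d)
    (row_ : nat -> 'I_m) (s t : nat -> 'I_n.+1) (k : nat) :
    'I_n.+1 -> 'cV[R]_d :=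
  if k is k'.+1
  then mrk_update (row_ k') (s k') (t k') (mrk_iterates x0 row_ s t k')
  else x0.

End Algorithm.

Section Randomness.
Context {R : realType} {disp : measure_display} {T : measurableType disp}.
Variable P : probability T R.

Definition finite_rv (A : finType) (X : T -> A) : Prop :=
  forall a, measurable (X @^-1` [set a]).

(* Independence of finitely-valued X and Y; on atoms this is equivalent to the *)
(* product rule for all events.                                                *)
Definition independent_rv (A B : finType) (X : T -> A) (Y : T -> B) : Prop :=
  forall a b, (P (X @^-1` [set a] `&` Y @^-1` [set b]) =
               P (X @^-1` [set a]) * P (Y @^-1` [set b]))%E.

Definition has_law (A : finType) (X : T -> A) (p : A -> R) : Prop :=
  forall a, P (X @^-1` [set a]) = (p a)%:E.

Section Run.
Context {n d m : nat}.
Variables (row_ : nat -> T -> 'I_m) (s : nat -> T -> 'I_n.+1)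
  (swap : nat -> T -> bool) (u : nat -> T -> 'I_n.+1).

(* Everything drawn or selected strictly before step k; the starting point     *)
(* being deterministic, it determines the iterates x_0, ..., x_k.              *)
Definition past (k : nat) (w : T) :
    {ffun 'I_k -> 'I_m * 'I_n.+1 * bool * 'I_n.+1} :=
  [ffun j : 'I_k => (row_ j w, s j w, swap j w, u j w)].

Definition target (k : nat) (w : T) : 'I_n.+1 :=
  if swap k w then u k w else s k w.

Definition mrk_process (M : 'M[R]_(m, d)) (b : 'cV[R]_m)
    (x0 : 'I_n.+1 -> 'cV[R]_d) (k : nat) (w : T) : 'I_n.+1 -> 'cV[R]_d :=
  mrk_iterates M b x0 (row_^~ w) (s^~ w) (target^~ w) k.

(* A run of the algorithm.  At step k, row_ k is the sampled row, s k the      *)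
(* selected minimizer, swap k the coin of bias r and u k the uniform index.    *)
(* Ties in the argmin are broken arbitrarily, possibly at random, but without  *)
(* knowledge of the randomness that is drawn afterwards.                       *)
Record mrk_run (M : 'M[R]_(m, d)) (b : 'cV[R]_m) (D : 'I_m -> R) (r : R)
    (x0 : 'I_n.+1 -> 'cV[R]_d) : Prop := MrkRun {
  run_row_rv : forall k, finite_rv (row_ k);
  run_s_rv : forall k, finite_rv (s k);
  run_swap_rv : forall k, finite_rv (swap k);
  run_u_rv : forall k, finite_rv (u k);
  run_row_law : forall k, has_law (row_ k) D;
  run_row_indep : forall k, independent_rv (row_ k) (past k);
  run_argmin : forall k w,
    is_argmin M b (row_ k w) (mrk_process M b x0 k w) (s k w);
  run_swap_law : forall k, has_law (swap k) (fun c => if c then r else 1 - r);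
  run_u_law : forall k, has_law (u k) (fun=> n.+1%:R^-1);
  run_swap_u_indep : forall k, independent_rv (swap k) (u k);
  run_fresh : forall k,
    independent_rv (fun w => (swap k w, u k w))
                   (fun w => (past k w, row_ k w, s k w)) }.

End Run.
End Randomness.

(* Main.v *)
(* Let V(x) be the sum of the squared distances of the iterates to the         *)
(* solutions, matched by some relabeling.  Any step moves one iterate towards  *)
(* a hyperplane by at most its distance to it; such relaxed projections onto   *)
(* finitely many hyperplanes preserve a bounded convex set, so V is bounded    *)
(* along the run.  By uniqueness, a configuration that is not a relabeling of  *)
(* the solutions leaves some row at positive distance from all iterates,       *)
(* quantitatively so since each assignment of rows to iterates is a linear     *)
(* system.  Hence, away from the solutions, sampling such a row and swapping   *)
(* to the iterate matched with its system decreases V by a fixed amount: a     *)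
(* neighborhood of the solutions is reached with probability bounded below.    *)
(* There the minimizer belongs to the sampled row, and for small r the value   *)
(* V / rho^k is a supermartingale for some rho < 1, so V decreases             *)
(* geometrically forever with probability at least 1/2.  A zero-one argument   *)
(* turns these uniform bounds into almost sure convergence.                    *)
Require Import Defs.
From HB Require Import structures.
From mathcomp Require Import all_boot all_order all_algebra all_fingroup.
From mathcomp Require Import all_classical all_reals all_analysis.
From mathcomp Require Import ring lra.
Set Implicit Arguments.
Unset Strict Implicit.
Unset Printing Implicit Defensive.
Import Order.TTheory GRing.Theory Num.Theory.
Import numFieldNormedType.Exports.
Local Open Scope classical_set_scope.
Local Open Scope ring_scope.

(** * Boundedness of relaxed projections onto hyperplanes *)

(** The potential is [lyap y x], where [y] labels the iterates by the solutions. If [y t] lies on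
    the hyperplane of the sampled row, moving iterate [t] lowers it by at least [gain], the least
    squared distance from an iterate to that hyperplane ([lyap_update_le]); any other move at most
    quadruples it ([lyap_update_growth]). Every step is a relaxed projection, so the potential is
    bounded along the run ([relaxed_proj_bounded]).

    Assigning each row to its closest iterate gives a linear system which, by uniqueness, is
    inconsistent or solved only by relabelings of [xstar]. Hence the expected gain is bounded below
    away from the relabelings ([mean_gain_away]) and dominates a multiple of the potential near each
    of them ([mean_gain_near]).

    After any history that is far from all relabelings, some draw of probability bounded below
    brings the iterates closer to [xstar] by a fixed amount; boundedly many such draws lead near
    some relabeling. There only swaps can do harm, so the mean potential contracts by 1 - c + 4r < 1
    ([lyap_drift]), and with probability at least 1/2 it decays geometrically forever
    ([pr_tube_ge]). Eventual decay thus has conditional probability bounded below given any history,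
    hence probability one ([zero_one]). *)

Lemma uniform_pos (R : realType) (I : finType) (Q : I -> R -> Prop) :
  (forall i c c', 0 < c' <= c -> Q i c -> Q i c') ->
  (forall i, exists2 c, 0 < c & Q i c) -> exists2 c, 0 < c & forall i, Q i c.
Proof.
move=> Qdown /(_ _)/cid2-/all_sig2[c c_gt0 Qc].
exists (\big[Num.min/1]_i c i) => [|i].
  by apply: (big_ind (fun x => 0 < x)) => // x y x0 y0; rewrite lt_min x0.
apply: Qdown (Qc i); apply/andP; split; last exact: bigmin_le_cond.
by apply: (big_ind (fun x => 0 < x)) => // x y x0 y0; rewrite lt_min x0.
Qed.

Section PsdForms.
Context {R : realType} {V : lmodType R}.
Implicit Types (B : V -> V -> R) (x y z : V) (t : R).

Record psd_form B : Prop := PsdForm {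
  psd_sym : forall x y, B x y = B y x;
  psd_linear : forall t x y z, B (x + t *: y) z = B x z + t * B y z;
  psd_ge0 : forall x, 0 <= B x x }.

Variables (B : V -> V -> R) (B_psd : psd_form B).

Lemma psd_linearr t x y z : B z (x + t *: y) = B z x + t * B z y.
Proof. by rewrite ![B z _]psd_sym// psd_linear. Qed.

Lemma psd_quad t x y :
  B (x + t *: y) (x + t *: y) = B x x + t * (B x y *+ 2) + t ^+ 2 * B y y.
Proof. by rewrite psd_linear// !psd_linearr (psd_sym B_psd y x); ring. Qed.

Lemma psd_cauchy_schwarz x y : B x y ^+ 2 <= B x x * B y y.
Proof.
have [y0|y0] := eqVneq (B y y) 0.
  rewrite y0 mulr0; have [->|xy0] := eqVneq (B x y) 0; first by rewrite expr0n.
  (* The form may be degenerate: if [B y y = 0] the quadratic is affine in the step, and this step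
     would bring it down to -1. *)
  have := psd_ge0 B_psd (x + (- (B x x + 1) / (B x y *+ 2)) *: y).
  rewrite psd_quad y0 mulr0 addr0 -mulrA mulVf ?mulrn_eq0 ?negb_or//.
  by rewrite mulr1 => ?; exfalso; lra.
have y_gt0 : 0 < B y y by rewrite lt_def y0 psd_ge0.
have := psd_ge0 B_psd (x + (- B x y / B y y) *: y).
rewrite psd_quad.
have -> : B x x + - B x y / B y y * (B x y *+ 2) + (- B x y / B y y) ^+ 2 * B y y
  = (B x x * B y y - B x y ^+ 2) / B y y by field.
by rewrite pmulr_lge0 ?invr_gt0// subr_ge0.
Qed.

Lemma psd_convex t x y : 0 <= t <= 1 ->
  B (x + t *: (y - x)) (x + t *: (y - x)) <= (1 - t) * B x x + t * B y y.
Proof.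
move=> t01; have := psd_ge0 B_psd (y - x).
have -> : B y y = B (x + 1 *: (y - x)) (x + 1 *: (y - x)).
  by rewrite scale1r addrC subrK.
rewrite !psd_quad => q0.
have : 0 <= t * (1 - t) * B (y - x) (y - x) by rewrite !mulr_ge0//; lra.
by move=> ?; lra.
Qed.

(** The form after projecting out [u], nonnegative by Cauchy-Schwarz. If [B u u = 0] the quotient is
    0 and the form is unchanged. *)
Lemma psd_reduce u :
  psd_form (fun x y => B x y - B x u * B u y / B u u).
Proof.
split=> [x y|t x y z|x].
- by rewrite psd_sym// (psd_sym B_psd x) (psd_sym B_psd u y); ring.
- by rewrite !psd_linear//; ring.
have [u0|u0] := eqVneq (B u u) 0; first by rewrite u0 invr0 mulr0 subr0 psd_ge0.
rewrite subr_ge0 ler_pdivrMr ?lt_def ?u0 ?psd_ge0//.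
by rewrite (psd_sym B_psd u) -expr2 psd_cauchy_schwarz.
Qed.

Lemma psd_rank1D E u : psd_form E ->
  psd_form (fun x y => E x y + B x u * B u y / B u u).
Proof.
move=> E_psd; split=> [x y|t x y z|x].
- by rewrite (psd_sym E_psd) (psd_sym B_psd x) (psd_sym B_psd u y); ring.
- by rewrite (psd_linear E_psd) (psd_linear B_psd); ring.
rewrite addr_ge0 ?psd_ge0// mulr_ge0 ?invr_ge0 ?psd_ge0//.
by rewrite (psd_sym B_psd u) -expr2 sqr_ge0.
Qed.

End PsdForms.

Section Residual.
Context {R : realType} {V : lmodType R}.
Variables (B : V -> V -> R) (B_psd : psd_form B).
Implicit Types (I : seq V) (x y u : V).

(* [residual I x x] is the squared B-distance from x to the span of I; thanks *)
(* to [_ / 0 = 0], a vector already in the span changes nothing.              *)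
Fixpoint residual I x y : R :=
  if I is u :: I' then
    residual I' x y - residual I' x u * residual I' u y / residual I' u u
  else B x y.

Lemma residual_psd I : psd_form (residual I).
Proof. by elim: I => //= u I IH; exact: psd_reduce. Qed.

(** The difference measures the projection onto the span; each vector of [I] adds a rank-one form to
    it. *)
Lemma residual_compl_psd I : psd_form (fun x y => B x y - residual I x y).
Proof.
elim: I => [|u I IH] /=.
  by split=> [x y|t x y z|x]; rewrite !subrr ?mulr0 ?addr0.
have := psd_rank1D (residual_psd I) u IH; congr psd_form.
by apply/funext => x; apply/funext => y; ring.
Qed.

Lemma residual_le I x : residual I x x <= B x x.
Proof. by have := psd_ge0 (residual_compl_psd I) x; rewrite subr_ge0. Qed.

Lemma residual_null I u : residual I u u = 0 -> forall x, residual I u x = 0.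
Proof.
move=> u0 x; have := psd_cauchy_schwarz (residual_psd I) u x.
by rewrite u0 mul0r => h; apply/eqP; rewrite -sqrf_eq0 eq_le h sqr_ge0.
Qed.

Lemma residual_head u I x : residual (u :: I) u x = 0.
Proof.
rewrite /=; have [u0|u0] := eqVneq (residual I u u) 0.
  by rewrite !(residual_null u0) mul0r mul0r subr0.
by field.
Qed.

Lemma residual_mem I u : u \in I -> residual I u u = 0.
Proof.
elim: I => // v I IH; rewrite inE => /predU1P[<-|/IH u0].
  exact: residual_head.
by rewrite /= !(residual_null u0) !mul0r subr0.
Qed.

Lemma residual_shift I u t x : residual I u u = 0 ->
  residual I (x + t *: u) (x + t *: u) = residual I x x.
Proof.
move=> u0; have rI := residual_psd I.
by rewrite psd_quad// (psd_sym rI x u) (residual_null u0) u0 mul0rn !mulr0 !addr0.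
Qed.

End Residual.

Section BoundedProjections.
Context {R : realType} {V : lmodType R} {J : finType}.
Variables (B : V -> V -> R) (B_psd : psd_form B) (u : J -> V) (beta : J -> R).
Hypothesis u_neq0 : forall l, 0 < B (u l) (u l).

Definition relaxed_proj l (t : R) x :=
  x + (t * ((beta l - B (u l) x) / B (u l) (u l))) *: u l.

(** [N], [b] and [C] dominate, for all rows at once, the squared norms of the normals, the offsets
    and the squared distances of the hyperplanes from 0. *)
Let N := \sum_l B (u l) (u l).
Let b := \sum_l `|beta l|.
Let C := \sum_l beta l ^+ 2 / B (u l) (u l).

(** Each increment pays for a component [tau] of size at most [b + 1 + (slack k' + C) * N] along a
    new normal whose squared distance to the span is at least [kappa]. *)
Let slack (kappa : nat -> R) := fix slack k : R :=
  if k is k'.+1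
  then slack k' + (b + 1 + (slack k' + C) * N) ^+ 2 / kappa k'.+1 else 0.

Let radius kappa R1 k := if k is k'.+1 then R1 - slack kappa k' else R1 + C.

Let q (I : seq J) x := residual B (map u I) x x.

(* An intersection of cylinders, one for each span of normals.  Their radii   *)
(* decrease with the dimension of the span, by gaps so large that the part of *)
(* the boundary crossing a hyperplane is parallel to its normal.              *)
Let cage kappa R1 x := forall I, uniq I -> q I x <= radius kappa R1 (size I).

Let N_ge l : B (u l) (u l) <= N.
Proof. by rewrite /N (bigD1 l)//= lerDl sumr_ge0// => i _; exact: psd_ge0. Qed.

Let b_ge l : `|beta l| <= b.
Proof. by rewrite /b (bigD1 l)//= lerDl sumr_ge0. Qed.

Let C_ge l : beta l ^+ 2 / B (u l) (u l) <= C.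
Proof.
rewrite /C (bigD1 l)//= lerDl sumr_ge0// => i _.
by rewrite divr_ge0 ?sqr_ge0 ?psd_ge0.
Qed.

Let N_ge0 : 0 <= N.
Proof. by apply: sumr_ge0 => i _; exact: psd_ge0. Qed.

Let C_ge0 : 0 <= C.
Proof. by apply: sumr_ge0 => i _; rewrite divr_ge0 ?sqr_ge0 ?psd_ge0. Qed.

(** For each length there are finitely many lists of normals, so the nonzero distances from normals
    to their spans have a positive minimum. *)
Let gap_exists : exists2 kappa : nat -> R, forall k, 0 < kappa k &
  forall I l, q I (u l) != 0 -> kappa (size I) <= q I (u l).
Proof.
suff /(_ _)/cid2-/all_sig2[kappa kappa_gt0 kappaP] k : exists2 c : R, 0 < c &
    forall p : k.-tuple J * J, q p.1 (u p.2) != 0 -> c <= q p.1 (u p.2).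
  by exists kappa => // I l; exact: kappaP (size I) (in_tuple I, l).
apply: uniform_pos => [p c c' /andP[_ c'c] cq /cq|p]; first exact: le_trans.
have [q0|q0] := eqVneq (q p.1 (u p.2)) 0; first by exists 1.
exists (q p.1 (u p.2)) => //.
by rewrite lt_def q0 psd_ge0//; exact: residual_psd.
Qed.

Section Cage.
Variables (kappa : nat -> R) (kappa_gt0 : forall k, 0 < kappa k).
Hypothesis kappa_le : forall I l, q I (u l) != 0 -> kappa (size I) <= q I (u l).
Variable R1 : R.

Let slack_mono : {homo slack kappa : j k / (j <= k)%N >-> j <= k}.
Proof.
apply: homo_leq => [//|? ? ?|k /=]; first exact: le_trans.
by rewrite lerDl divr_ge0 ?sqr_ge0 ?ltW.
Qed.

Let slack_ge0 k : 0 <= slack kappa k.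
Proof. by rewrite -[leLHS]/(slack kappa 0) slack_mono. Qed.

(** Only spans of [I] missing [u l] need care. If the part [tau] of the product of [y] with [u l]
    that is orthogonal to the span is small, the gap between consecutive radii absorbs it. If it is
    large, the part in the span must nearly cancel it, as [y] is on the hyperplane; this leaves
    little room for [q I y] under the bound on [B y y]. *)
Lemma cage_proj l x : cage kappa R1 x -> cage kappa R1 (relaxed_proj l 1 x).
Proof.
move=> Kx I I_uniq; set y := relaxed_proj l 1 x.
have uy : B (u l) y = beta l.
  rewrite /y /relaxed_proj psd_linearr//.
  by field; rewrite gt_eqF.
have rI := residual_psd B_psd (map u I).
have [q0|q0] := eqVneq (q I (u l)) 0.
  by rewrite /q residual_shift//; exact: Kx.
have lI : l \notin I.
  by apply: contra q0 => lI; rewrite /q residual_mem ?map_f.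
have qlE : q (l :: I) y <= radius kappa R1 (size I).+1.
  rewrite /q residual_shift ?residual_head//.
  by apply: (Kx (l :: I)); rewrite /= lI.
have qE : q I y = q (l :: I) y + residual B (map u I) (u l) y ^+ 2 / q I (u l).
  by rewrite /q /= (psd_sym rI y (u l)); ring.
(* Pythagoras along [u l]: the orthogonal part is unchanged by the projection and the other is the
   squared distance of the hyperplane from 0. *)
have yle : B y y <= R1 + C.
  have /= := Kx [:: l] isT; rewrite subr0 => ql.
  have ql' : q [:: l] y <= R1.
    by rewrite /q residual_shift ?residual_head.
  have := C_ge l; move: ql'; rewrite /q /= (psd_sym B_psd y) uy -expr2; lra.
case: I => [|i I] in I_uniq rI q0 lI qlE qE *; first exact: yle.
rewrite /= in qlE *.
set I' := i :: I in I_uniq rI q0 lI qlE qE *.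
set A := slack kappa (size I) in qlE *.
set tau := residual B (map u I') (u l) y in qE.
set T : R := b + 1 + (A + C) * N in qlE.
have AC0 : 0 <= A + C by rewrite addr_ge0 ?slack_ge0.
have ACN0 : 0 <= (A + C) * N by rewrite mulr_ge0.
have b0 : 0 <= b by rewrite sumr_ge0.
have q_gt0 : 0 < q I' (u l) by rewrite lt_def q0 psd_ge0.
have [tauT|tauT] := lerP `|tau| T.
  have : tau ^+ 2 / q I' (u l) <= T ^+ 2 / kappa (size I').
    apply: ler_pM; rewrite ?sqr_ge0 ?invr_ge0 ?(ltW q_gt0)//.
      by rewrite -[tau ^+ 2]real_normK ?num_real// ler_sqr ?nnegrE// (le_trans _ tauT).
    by rewrite lef_pV2 ?posrE// kappa_le.
  by rewrite qE; move: qlE => /=; lra.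
(* If [q I' y] exceeded the radius [R1 - A], the part of [y] in the span would have squared length
   at most [A + C]; Cauchy-Schwarz there contradicts the size of [tau]. *)
rewrite leNgt; apply/negP => qy.
have E_psd := residual_compl_psd B_psd (map u I').
have := psd_cauchy_schwarz E_psd (u l) y; rewrite uy -/tau.
have := psd_ge0 E_psd y; rewrite -/(q I' y).
have := psd_ge0 E_psd (u l); rewrite -/(q I' (u l)).
set euu := _ - _ => euu0; set eyy := _ - _ => eyy0 cs.
have euuN : euu <= N by rewrite /euu; have := N_ge l; lra.
have eyyA : eyy <= A + C by rewrite /eyy; lra.
have le1 : euu * eyy <= N * (A + C) by exact: ler_pM.
have : 1 + (A + C) * N <= `|beta l - tau|.
  have := lerB_dist tau (beta l); rewrite distrC; have := b_ge l.
  by move: tauT; rewrite /T; lra.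
rewrite -ler_sqr ?nnegrE ?addr_ge0// real_normK ?num_real// => le2.
have : (1 + (A + C) * N) ^+ 2 <= N * (A + C) by rewrite (le_trans le2)// (le_trans cs).
by rewrite sqrrD; nra.
Qed.

(** A relaxed projection lies on the segment from [x] to its projection, and the cage is convex. *)
Lemma cage_relaxed_proj l t x :
  0 <= t <= 1 -> cage kappa R1 x -> cage kappa R1 (relaxed_proj l t x).
Proof.
move=> t01 Kx I I_uniq.
have -> : relaxed_proj l t x = x + t *: (relaxed_proj l 1 x - x).
  by rewrite /relaxed_proj [_ - x]addrC addKr scalerA mul1r.
apply: le_trans (psd_convex (residual_psd B_psd _) _ _ t01) _.
have := Kx I I_uniq; have := cage_proj l Kx I_uniq.
by move: t01 => /andP[]; rewrite /q; nra.
Qed.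

Lemma ball_cage r0 x :
  r0 + slack kappa #|J| <= R1 -> B x x <= r0 -> cage kappa R1 x.
Proof.
move=> r0R1 xr0 I /card_uniqP I_card.
apply: le_trans (residual_le B_psd _ _) (le_trans xr0 _).
case: I I_card => [|i I] /= Ic.
  by have := slack_ge0 #|J|; have := C_ge0; lra.
have : slack kappa (size I) <= slack kappa #|J|.
  by apply: slack_mono; rewrite ltnW// -[(_ < _)%N]/((size I).+1 <= _)%N -Ic max_card.
lra.
Qed.

End Cage.

Lemma relaxed_proj_bounded r0 : exists (K : V -> Prop) (R0 : R),
  [/\ forall x, B x x <= r0 -> K x, forall x, K x -> B x x <= R0 &
      forall l t x, 0 <= t <= 1 -> K x -> K (relaxed_proj l t x)].
Proof.
have [kappa kappa_gt0 kappa_le] := gap_exists.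
pose R1 := r0 + slack kappa #|J|.
exists (cage kappa R1), (R1 + C); split=> [x|x /(_ [::] isT)//|].
  exact: ball_cage.
exact: cage_relaxed_proj.
Qed.

End BoundedProjections.

(** * Geometry of one step *)

Section Euclidean.
Context {R : realType}.

Definition dot {d} (x y : 'cV[R]_d) : R := \sum_j x j 0 * y j 0.
Definition sqnorm {d} (x : 'cV[R]_d) : R := dot x x.

Lemma dot_psd d : psd_form (@dot d).
Proof.
split=> [x y|t x y z|x].
- by apply: eq_bigr => j _; rewrite mulrC.
- rewrite /dot mulr_sumr -big_split/=.
  by apply: eq_bigr => j _; rewrite !mxE; ring.
- by apply: sumr_ge0 => j _; rewrite -expr2 sqr_ge0.
Qed.

Lemma dotZr d t (x y : 'cV[R]_d) : dot x (t *: y) = t * dot x y.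
Proof. by rewrite /dot mulr_sumr; apply: eq_bigr => j _; rewrite mxE mulrCA. Qed.

Lemma sqnorm_ge0 d (x : 'cV[R]_d) : 0 <= sqnorm x.
Proof. exact: psd_ge0 (dot_psd d) x. Qed.

Lemma sqnormN d (x : 'cV[R]_d) : sqnorm (- x) = sqnorm x.
Proof. by apply: eq_bigr => j _; rewrite mxE mulrNN. Qed.

Lemma sqnormZ d t (x : 'cV[R]_d) : sqnorm (t *: x) = t ^+ 2 * sqnorm x.
Proof. by rewrite /sqnorm dotZr (psd_sym (dot_psd d)) dotZr; ring. Qed.

Lemma sqnorm_eq0 d (x : 'cV[R]_d) : sqnorm x = 0 -> x = 0.
Proof.
move=> /eqP; rewrite psumr_eq0 => [/allP x0|j _]; last by rewrite -expr2 sqr_ge0.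
apply/colP => j; have := x0 j (mem_index_enum _).
by rewrite mxE /= -expr2 sqrf_eq0 => /eqP.
Qed.

Lemma sqnorm_ge_entry d (x : 'cV[R]_d) j : x j 0 ^+ 2 <= sqnorm x.
Proof.
rewrite /sqnorm /dot (bigD1 j)//= expr2 lerDl.
by apply: sumr_ge0 => k _; rewrite -expr2 sqr_ge0.
Qed.

Lemma sqnormD_le d (x y : 'cV[R]_d) :
  sqnorm (x + y) <= 2 * sqnorm x + 2 * sqnorm y.
Proof.
have := psd_quad (dot_psd d) 1 x y; have := psd_quad (dot_psd d) (-1) x y.
rewrite !scale1r scaleN1r /sqnorm; have := psd_ge0 (dot_psd d) (x - y); lra.
Qed.

Lemma sqnorm_mulmx_le d k (B : 'M[R]_(k, d)) :
  exists2 C, 0 < C & forall x, sqnorm (B *m x) <= C * sqnorm x.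
Proof.
exists (1 + \sum_i sqnorm (row i B)^T) => [|x].
  by rewrite ltr_pwDl ?sumr_ge0// => i _; exact: sqnorm_ge0.
apply: (@le_trans _ _ ((\sum_i sqnorm (row i B)^T) * sqnorm x)); last first.
  by rewrite mulrDl mul1r lerDr sqnorm_ge0.
rewrite mulr_suml {1}/sqnorm /dot; apply: ler_sum => i _.
rewrite -expr2; have := psd_cauchy_schwarz (dot_psd d) (row i B)^T x.
by rewrite {1}/dot mxE; under eq_bigr => j _ do rewrite !mxE.
Qed.

(** An injective matrix has a left inverse, which is a bounded operator. *)
Lemma sqnorm_injective_ge d k (A : 'M[R]_(k, d)) :
  (forall v : 'cV_d, A *m v = 0 -> v = 0) ->
  exists2 c, 0 < c & forall v, c * sqnorm v <= sqnorm (A *m v).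
Proof.
move=> A_inj; have Afree : row_free A^T.
  rewrite -kermx_eq0; apply/eqP/row_matrixP => i; rewrite row0.
  apply: trmx_inj; rewrite trmx0; apply: A_inj; apply: trmx_inj.
  by rewrite trmx_mul trmxK trmx0 -row_mul mulmx_ker row0.
have [C C_gt0 leC] := sqnorm_mulmx_le (pinvmx A^T)^T.
exists C^-1 => [|v]; first by rewrite invr_gt0.
rewrite mulrC ler_pdivrMr// mulrC; apply: le_trans (leC _).
have BA : (pinvmx A^T)^T *m A = 1%:M.
  by apply: trmx_inj; rewrite trmx_mul trmxK mulmxVp// trmx1.
by rewrite mulmxA BA mul1mx.
Qed.

(** A cokernel matrix kills the range of [A] but not [c], so it sends every [A *m v - c] to the same
    nonzero vector. *)
Lemma sqnorm_inconsistent_ge d k (A : 'M[R]_(k, d)) (c : 'cV[R]_k) :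
  (forall v, A *m v <> c) ->
  exists2 e, 0 < e & forall v, e <= sqnorm (A *m v - c).
Proof.
move=> Ac; pose B := (cokermx A^T)^T.
have Bc0 : B *m c != 0.
  apply/eqP => /(congr1 trmx); rewrite trmx_mul trmxK trmx0 => /eqP cA.
  have /submxP[w /(congr1 trmx)] : (c^T <= A^T)%MS by rewrite submxE.
  by rewrite trmx_mul !trmxK => /esym; exact: Ac.
have [C C_gt0 leC] := sqnorm_mulmx_le B.
have Bc_gt0 : 0 < sqnorm (B *m c).
  by rewrite lt_def sqnorm_ge0 andbT; apply: contra Bc0 => /eqP/sqnorm_eq0->.
exists (sqnorm (B *m c) / C) => [|v]; first by rewrite divr_gt0.
rewrite ler_pdivrMr// mulrC; apply: le_trans (leC _).
rewrite mulmxBr mulmxA.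
have -> : B *m A = 0.
  by apply: trmx_inj; rewrite trmx_mul trmxK trmx0 mulmx_coker.
by rewrite mul0mx sub0r sqnormN.
Qed.

End Euclidean.

Section Geometry.
Context {R : realType} {n d m : nat}.
Variables (M : 'M[R]_(m, d)) (b : 'cV[R]_m).
Hypothesis M_nonzero_rows : forall l, row l M != 0.
Implicit Types (l : 'I_m) (i t : 'I_n.+1) (v z : 'cV[R]_d).
Implicit Types (x y : 'I_n.+1 -> 'cV[R]_d).

Definition row_normal l : 'cV[R]_d := (row l M)^T.
Definition misfit l z : R := dot (row_normal l) z - b l 0.
Definition sqdist l z : R := misfit l z ^+ 2 / sqnorm (row_normal l).

Lemma normal_gt0 l : 0 < sqnorm (row_normal l).
Proof.
rewrite lt_def sqnorm_ge0 andbT; apply: contra (M_nonzero_rows l).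
by move=> /eqP/sqnorm_eq0 Ml0; rewrite -[row l M]trmxK -/(row_normal l) Ml0 trmx0.
Qed.

Lemma row_mulmxE l z : (row l M *m z) 0 0 = dot (row_normal l) z.
Proof. by rewrite mxE; apply: eq_bigr => j _; rewrite !mxE. Qed.

Lemma euclid_normE l : euclid_norm (row l M) ^+ 2 = sqnorm (row_normal l).
Proof.
rewrite sqr_sqrtr ?sumr_ge0// => [|j _]; last exact: sqr_ge0.
by apply: eq_bigr => j _; rewrite !mxE expr2.
Qed.

Lemma mrk_coefE l z : mrk_coef M b l z = misfit l z / sqnorm (row_normal l).
Proof. by rewrite /mrk_coef row_mulmxE euclid_normE. Qed.

Lemma sqdistE l z : sqdist l z = mrk_coef M b l z ^+ 2 * sqnorm (row_normal l).
Proof.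
by rewrite mrk_coefE /sqdist; field; rewrite gt_eqF ?normal_gt0.
Qed.

Lemma misfitD l z v : misfit l (z + v) = misfit l z + dot (row_normal l) v.
Proof.
by have := psd_linearr (dot_psd d) 1 z v (row_normal l);
  rewrite scale1r mul1r /misfit => ->; ring.
Qed.

Lemma dot_normalB l z v : misfit l v = 0 -> dot (row_normal l) (z - v) = misfit l z.
Proof.
by move=> v0; have := misfitD l v (z - v); rewrite [v + _]addrC subrK v0 add0r.
Qed.

Lemma sqdist_le l z v : misfit l v = 0 -> sqdist l z <= sqnorm (z - v).
Proof.
move=> v0; rewrite ler_pdivrMr ?normal_gt0// -(dot_normalB z v0) mulrC.
exact: psd_cauchy_schwarz (dot_psd d) _ _.
Qed.

Lemma sqdist_perturb l z v : sqdist l z <= 2 * sqdist l v + 2 * sqnorm (z - v).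
Proof.
have cs := psd_cauchy_schwarz (dot_psd d) (row_normal l) (z - v).
have sq2 : misfit l z ^+ 2 <= 2 * misfit l v ^+ 2 + 2 * dot (row_normal l) (z - v) ^+ 2.
  have -> : misfit l z = misfit l v + dot (row_normal l) (z - v).
    by rewrite -misfitD [v + _]addrC subrK.
  move: (misfit l v) (dot _ _) => e f.
  by have := sqr_ge0 (e - f); rewrite sqrrB sqrrD; lra.
rewrite /sqdist ler_pdivrMr ?normal_gt0// mulrDl -mulrA mulfVK ?gt_eqF ?normal_gt0//.
by apply: le_trans sq2 _; rewrite lerD2l -mulrA ler_pM2l// mulrC.
Qed.

Definition closest l x : 'I_n.+1 :=
  [arg min_(i < ord0) `|mrk_coef M b l (x i)|]%O.

Definition gain l x : R := sqdist l (x (closest l x)).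

Definition update l t x := mrk_update M b l (closest l x) t x.

Lemma closest_le l x i :
  `|mrk_coef M b l (x (closest l x))| <= `|mrk_coef M b l (x i)|.
Proof. by rewrite /closest; case: arg_minP => // j _; exact. Qed.

(** A step uses only the minimal value of the coefficients, so the way ties are broken is irrelevant
    and [closest] may stand for any minimizer. *)
Lemma update_argmin l (s t : 'I_n.+1) x :
  is_argmin M b l x s -> mrk_update M b l s t x = update l t x.
Proof.
move=> s_min; apply/funext => j; rewrite /update /mrk_update.
suff -> : `|mrk_coef M b l (x s)| = `|mrk_coef M b l (x (closest l x))| by [].
by apply/eqP; rewrite eq_le s_min closest_le.
Qed.

Lemma gain_ge0 l x : 0 <= gain l x.
Proof. by rewrite /gain sqdistE mulr_ge0 ?sqr_ge0 ?sqnorm_ge0. Qed.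

Lemma gain_le_sqdist l x i : gain l x <= sqdist l (x i).
Proof.
rewrite /gain !sqdistE ler_wpM2r ?sqnorm_ge0//.
by rewrite -real_normK ?num_real// -[leRHS]real_normK ?num_real//
  ler_sqr ?nnegrE// closest_le.
Qed.

(** The relaxation factor is the ratio of the minimal coefficient to that of the target, hence at
    most 1. *)
Lemma update_relaxed_proj l t x i : exists2 a, 0 <= a <= 1 &
  update l t x i = relaxed_proj dot row_normal (fun l => b l 0) l a (x i).
Proof.
rewrite /update /mrk_update /relaxed_proj.
case: eqVneq => [->|_]; last first.
  by exists 0; rewrite ?lexx ?ler01// mul0r scale0r addr0.
have := closest_le l x t; set delta := `|_|; rewrite -/(row_normal l).
have -> : (b l 0 - dot (row_normal l) (x t)) / dot (row_normal l) (row_normal l) =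
    - mrk_coef M b l (x t).
  by rewrite mrk_coefE -mulNr opprB.
set c := mrk_coef M b l (x t) => delta_c.
have [c0|c0] := eqVneq c 0.
  by exists 0; rewrite ?lexx ?ler01// mul0r c0 sgr0 mulr0 scale0r subr0 addr0.
exists (delta / `|c|).
  by rewrite divr_ge0 ?normr_ge0//= ler_pdivrMr ?normr_gt0// mul1r.
rewrite -scaleNr; congr (_ + _ *: _); rewrite mulrN -mulrA; congr (- (_ * _)).
by rewrite {3}(numEsg c) mulrCA mulVf ?normr_eq0// mulr1.
Qed.

Definition lyap y x : R := \sum_i sqnorm (x i - y i).

Lemma lyap_ge0 y x : 0 <= lyap y x.
Proof. by apply: sumr_ge0 => i _; exact: sqnorm_ge0. Qed.

Lemma sqnorm_le_lyap y x i : sqnorm (x i - y i) <= lyap y x.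
Proof.
by rewrite /lyap (bigD1 i)//= lerDl sumr_ge0// => j _; exact: sqnorm_ge0.
Qed.

Lemma lyap_update y l t x : lyap y (update l t x) =
  lyap y x - sqnorm (x t - y t) + sqnorm (update l t x t - y t).
Proof.
rewrite /lyap (bigD1 t)//= [in RHS](bigD1 t)//= addrC; congr (_ + _).
rewrite addrAC subrr add0r; apply: eq_bigr => j jt.
by rewrite /update /mrk_update (negbTE jt).
Qed.

(** Here [a] is the signed step. The first bound limits any move; the second, which says that the
    step is no shorter than the least distance and does not overshoot, yields the decrease when the
    solution is on the hyperplane. *)
Lemma update_step l t x v : exists2 a : R, a ^+ 2 * sqnorm (row_normal l) <= gain l x /\
    gain l x + a ^+ 2 * sqnorm (row_normal l) <= 2 * (a * misfit l (x t)) &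
  update l t x t - v = x t - v + (- a) *: row_normal l.
Proof.
have N0 := normal_gt0 l; rewrite /gain sqdistE /update /mrk_update eqxx.
have := closest_le l x t; set delta := `|_| => delta_c.
set c := mrk_coef M b l (x t) in delta_c *.
exists (delta * Num.sg c); last by rewrite scaleNr addrAC.
have d0 : 0 <= delta by exact: normr_ge0.
have -> : misfit l (x t) = c * sqnorm (row_normal l).
  by rewrite /c mrk_coefE mulfVK ?gt_eqF.
rewrite -[mrk_coef _ _ _ _ ^+ 2]real_normK ?num_real// -/delta.
have -> : delta * Num.sg c * (c * sqnorm (row_normal l)) =
    delta * `|c| * sqnorm (row_normal l) by rewrite normrEsg; ring.
rewrite exprMn sqr_sg.
have [c0|c0] := eqVneq c 0.
  have -> : delta = 0 by apply/eqP; rewrite eq_le d0 andbT -(normr0 R) -c0.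
  by rewrite expr0n /= !mul0r addr0 mulr0.
rewrite mulr1; split=> //; rewrite -mulrDl [leRHS]mulrA ler_pM2r//.
by have : delta * delta <= delta * `|c| by [rewrite ler_wpM2l]; rewrite expr2; lra.
Qed.

Lemma lyap_update_le l t x y :
  misfit l (y t) = 0 -> lyap y (update l t x) <= lyap y x - gain l x.
Proof.
move=> yt0; have [a [_ ha] aE] := update_step l t x (y t).
rewrite lyap_update -addrA lerD2l aE /sqnorm (psd_quad (dot_psd d)).
rewrite (psd_sym (dot_psd d) (x t - y t)) dot_normalB// -/(sqnorm (row_normal l)) sqrrN.
by move: ha; lra.
Qed.

Lemma gain_le_lyap l x y i : misfit l (y i) = 0 -> gain l x <= lyap y x.
Proof.
move=> yi0; apply: le_trans (gain_le_sqdist l x i) _.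
exact: le_trans (sqdist_le _ yi0) (sqnorm_le_lyap _ _ _).
Qed.

(** The moved term becomes at most twice itself plus twice the squared step, and the latter is at
    most [gain], itself bounded by the potential. *)
Lemma lyap_update_growth l t x y i :
  misfit l (y i) = 0 -> lyap y (update l t x) <= 4 * lyap y x.
Proof.
move=> yi0; have [a [ha _] aE] := update_step l t x (y t).
have := sqnormD_le (x t - y t) (- a *: row_normal l).
rewrite sqnormZ sqrrN -aE lyap_update; have := gain_le_lyap x yi0.
by have := sqnorm_le_lyap y x t; lra.
Qed.

End Geometry.

(** * Coercivity from uniqueness *)

Section Coercivity.
Context {R : realType} {n d m : nat}.
Variables (M : 'M[R]_(m, d)) (b : 'cV[R]_m) (xstar : 'I_n.+1 -> 'cV[R]_d).
Hypothesis M_nonzero_rows : forall l, row l M != 0.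
Hypothesis uniqueness : unique_up_to_relabeling M b xstar.
Implicit Types (l : 'I_m) (i t : 'I_n.+1) (v z : 'cV[R]_d).
Implicit Types (x y : 'I_n.+1 -> 'cV[R]_d) (sigma : 'S_n.+1).
Implicit Types (phi : {ffun 'I_m -> 'I_n.+1}) (S : {set 'I_m}).

Local Notation misfit := (misfit M b).
Local Notation row_normal := (row_normal M).

Definition solution sigma i := xstar (sigma i).

Let covers phi y := forall l, misfit l (y (phi l)) = 0.

Lemma covers_solution phi y : covers phi y ->
  exists sigma, y = solution sigma.
Proof.
move=> yP; have [l|sigma sigmaP] := uniqueness (x := y).
  exists (phi l); rewrite row_mulmxE; apply/eqP.
  by rewrite -subr_eq0; apply/eqP; exact: yP.
exists (sigma^-1)%g; apply/funext => i.
by rewrite /solution sigmaP permKV.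
Qed.

(* A nonzero kernel vector would give a whole line of solutions. *)
Lemma covers_kernel phi y i v : covers phi y ->
  (forall l, phi l = i -> dot (row_normal l) v = 0) -> v = 0.
Proof.
move=> yP v0; apply/eqP/negP => /negP v_neq0.
pose z (k : nat) j := y j + (if j == i then k%:R else 0) *: v.
have zP k : covers phi (z k).
  move=> l; rewrite /z misfitD yP add0r.
  by rewrite dotZr; case: eqP => [/v0->|_]; rewrite ?mulr0 ?mul0r.
have /choice[tau tauP] k : exists sigma, z k = solution sigma.
  exact: covers_solution (zP k).
have : ~ injective (fun k : 'I_#|'S_n.+1|.+1 => tau k).
  by move=> /leq_card; rewrite card_ord ltnn.
apply=> j k tau_jk; apply/val_inj.
have : z j i = z k i by rewrite !tauP tau_jk.
rewrite /z eqxx => /addrI/eqP; rewrite -subr_eq0 -scalerBl scaler_eq0.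
by rewrite (negbTE v_neq0) orbF subr_eq0 eqr_nat => /eqP.
Qed.

(** Rows outside [S] are zeroed rather than deleted, so that all blocks have the same dimensions. *)
Let rows_of S : 'M[R]_(m, d) := \matrix_(l, j) (if l \in S then M l j else 0).
Let rhs_of S : 'cV[R]_m := \col_l (if l \in S then b l 0 else 0).

Let rows_ofE S z l :
  (rows_of S *m z) l 0 = if l \in S then dot (row_normal l) z else 0.
Proof.
rewrite mxE; case: ifPn => lS; last first.
  by rewrite big1// => j _; rewrite mxE (negbTE lS) mul0r.
by apply: eq_bigr => j _; rewrite !mxE lS.
Qed.

Let sqnorm_rows_of S z : sqnorm (rows_of S *m z - rhs_of S) =
  \sum_(l in S) misfit l z ^+ 2.
Proof.
rewrite [RHS]big_mkcond; apply: eq_bigr => l _.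
rewrite mxE rows_ofE !mxE.
by case: ifPn => _; rewrite ?subr0 ?mul0r// expr2.
Qed.

Let rows_coercive S : (forall v, (forall l, l \in S -> dot (row_normal l) v = 0) -> v = 0) ->
  exists2 c, 0 < c & forall x z : 'cV[R]_d, (forall l, l \in S -> misfit l z = 0) ->
    c * sqnorm (x - z) <= \sum_(l in S) misfit l x ^+ 2.
Proof.
move=> S_ker; have [v v0|c c_gt0 cP] := @sqnorm_injective_ge R _ _ (rows_of S).
  apply: S_ker => l lS; have /colP/(_ l) := v0.
  by rewrite rows_ofE lS mxE.
exists c => // x z zP; rewrite (le_trans (cP _))// -sqnorm_rows_of.
rewrite mulmxBr; suff -> : rows_of S *m z = rhs_of S by [].
apply/colP => l; rewrite rows_ofE mxE; case: ifPn => // lS.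
by apply/eqP; rewrite -subr_eq0; apply/eqP; exact: zP.
Qed.

Let rows_inconsistent S :
  (forall z, ~ forall l, l \in S -> misfit l z = 0) ->
  exists2 c, 0 < c & forall x : 'cV[R]_d, c <= \sum_(l in S) misfit l x ^+ 2.
Proof.
move=> S_incons; have [z zP|c c_gt0 cP] :=
  @sqnorm_inconsistent_ge R _ _ (rows_of S) (rhs_of S).
  apply: (S_incons z) => l lS; have /colP/(_ l) := zP.
  by rewrite rows_ofE mxE lS /misfit => ->; rewrite subrr.
by exists c => // x; rewrite -sqnorm_rows_of.
Qed.

Let total_misfit phi x := \sum_l misfit l (x (phi l)) ^+ 2.

Let block phi i : {set 'I_m} := [set l | phi l == i].

Let total_misfitE phi x :
  total_misfit phi x = \sum_i \sum_(l in block phi i) misfit l (x i) ^+ 2.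
Proof.
rewrite /total_misfit (partition_big phi xpredT)//=; apply: eq_bigr => i _.
by apply: eq_big => [l|l /eqP->//]; rewrite inE.
Qed.

(** The system splits into one block per iterate, each injective by [covers_kernel]; there are
    finitely many assignments. *)
Lemma total_misfit_coercive : exists2 c, 0 < c &
  forall phi y, covers phi y -> forall x, c * lyap y x <= total_misfit phi x.
Proof.
apply: uniform_pos => [phi c c' /andP[_ c'c] cP y yP x|phi].
  by rewrite (le_trans _ (cP y yP x))// ler_wpM2r ?lyap_ge0.
have [[y0 y0P]|noy] := pselect (exists y, covers phi y); last first.
  by exists 1 => // y yP; exfalso; apply: noy; exists y.
have [i c c' /andP[_ c'c] cP x z zP|i|c c_gt0 cP] :=
  uniform_pos (I := 'I_n.+1) (Q := fun i c => forall x z : 'cV[R]_d,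
    (forall l, l \in block phi i -> misfit l z = 0) ->
    c * sqnorm (x - z) <= \sum_(l in block phi i) misfit l x ^+ 2).
- by rewrite (le_trans _ (cP x z zP))// ler_wpM2r ?sqnorm_ge0.
- apply: rows_coercive => v v0; apply: (covers_kernel y0P (i := i)) => l li.
  by apply: v0; rewrite inE li.
exists c => // y yP x; rewrite total_misfitE /lyap mulr_sumr.
apply: ler_sum => i _; apply: cP => l; rewrite inE => /eqP <-; exact: yP.
Qed.

(** If every block had a solution, these would together cover all rows; so some block is
    inconsistent, and its misfit alone suffices. *)
Lemma total_misfit_inconsistent : exists2 c, 0 < c &
  forall phi, (forall y, ~ covers phi y) -> forall x, c <= total_misfit phi x.
Proof.
apply: uniform_pos => [phi c c' /andP[_ c'c] cP noy x|phi].
  exact: le_trans (cP noy x).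
have [[y0 y0P]|noy] := pselect (exists y, covers phi y).
  by exists 1 => // noy; case: (noy y0).
have [i iP] : exists i, forall z, ~ forall l, l \in block phi i -> misfit l z = 0.
  apply: contrapT => /forallNP all_i; apply: noy.
  have /choice[y yP] i : exists z, forall l, l \in block phi i -> misfit l z = 0.
    by apply: contrapT => /forallNP; exact: all_i.
  by exists y => l; apply: yP; rewrite inE.
have [c c_gt0 cP] := rows_inconsistent iP.
exists c => // _ x; rewrite total_misfitE (bigD1 i)//= (le_trans (cP (x i)))//.
by rewrite lerDl !sumr_ge0// => j _; rewrite sumr_ge0// => l _; exact: sqr_ge0.
Qed.

Variables (D : 'I_m -> R) (D_pos : forall l, 0 < D l).

Definition mean_gain x : R := \sum_l D l * gain M b l x.

Let total_misfit_le_mean_gain : exists2 c, 0 < c & forall x,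
  c * total_misfit [ffun l => closest M b l x] x <= mean_gain x.
Proof.
have [l c c' /andP[_ c'c] cP|l|c c_gt0 cP] := uniform_pos (I := 'I_m)
  (Q := fun l c => c * sqnorm (row_normal l) <= D l).
- by rewrite (le_trans _ cP)// ler_wpM2r ?sqnorm_ge0.
- exists (D l / sqnorm (row_normal l)); first by rewrite divr_gt0 ?normal_gt0.
  by rewrite divfK// gt_eqF ?normal_gt0.
exists c => // x; rewrite mulr_sumr; apply: ler_sum => l _; rewrite ffunE.
have := ler_wpM2r (gain_ge0 b M_nonzero_rows l x) (cP l).
by rewrite -mulrA [sqnorm _ * _]mulrC divfK// gt_eqF ?normal_gt0.
Qed.

Lemma mean_gain_away e : 0 < e -> exists2 c, 0 < c &
  forall x, (forall sigma, e <= lyap (solution sigma) x) -> c <= mean_gain x.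
Proof.
move=> e_gt0; have [c1 c1_gt0 c1P] := total_misfit_coercive.
have [c2 c2_gt0 c2P] := total_misfit_inconsistent.
have [c c_gt0 cP] := total_misfit_le_mean_gain.
exists (c * Num.min (c1 * e) c2) => [|x xP].
  by rewrite mulr_gt0// lt_min c2_gt0 mulr_gt0.
apply: le_trans (cP x); rewrite ler_pM2l//.
set phi := finfun _; rewrite ge_min.
have [[y yP]|noy] := pselect (exists y, covers phi y); last first.
  by apply/orP; right; apply: c2P => y yP; apply: noy; exists y.
apply/orP; left; apply: le_trans (c1P _ _ yP x); rewrite ler_pM2l//.
by have [sigma ->] := covers_solution yP.
Qed.

Lemma mean_gain_near : (forall l, exists i, misfit l (xstar i) = 0) ->
  exists2 e, 0 < e & exists2 c, 0 < c &
  forall sigma x, lyap (solution sigma) x <= e ->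
    (forall l s, is_argmin M b l x s -> misfit l (solution sigma s) = 0) /\
    c * lyap (solution sigma) x <= mean_gain x.
Proof.
move=> xstarP.
have [p c c' /andP[_ c'c] cP p0|[l i] /=|g g_gt0 gP] := uniform_pos
  (I := ('I_m * 'I_n.+1)%type) (Q := fun p c =>
     misfit p.1 (xstar p.2) != 0 -> c <= sqdist M b p.1 (xstar p.2)).
- exact: le_trans (cP p0).
- have [l0|l0] := eqVneq (misfit l (xstar i)) 0; first by exists 1.
  exists (sqdist M b l (xstar i)) => //.
  by rewrite divr_gt0 ?normal_gt0// lt_def sqr_ge0 sqrf_eq0 l0.
have [c1 c1_gt0 c1P] := total_misfit_coercive.
have [c c_gt0 cP] := total_misfit_le_mean_gain.
(* [g] bounds below the nonzero squared distances from solutions to hyperplanes. A minimizer whose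
   solution is off the hyperplane would give [g] at most 2 gain + 2 V, hence at most 4 V and so
   [g / 2]. *)
exists (g / 8); first by rewrite divr_gt0.
exists (c * c1) => [|sigma x xe]; first by rewrite mulr_gt0.
have near l s : is_argmin M b l x s -> misfit l (solution sigma s) = 0.
  move=> s_min; apply/eqP; apply: contraT => /(gP (l, sigma s))/=.
  have [i i0] := xstarP l; have yi0 : misfit l (solution sigma (sigma^-1 i)%g) = 0.
    by rewrite /solution permKV.
  have := gain_le_lyap M_nonzero_rows x yi0.
  have : sqdist M b l (x s) <= gain M b l x.
    rewrite /gain !sqdistE// ler_wpM2r ?sqnorm_ge0//.
    by rewrite -real_normK ?num_real// -[leRHS]real_normK ?num_real//
      ler_sqr ?nnegrE.
  have := sqdist_perturb b M_nonzero_rows l (solution sigma s) (x s).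
  rewrite -[sqnorm _]sqnormN opprB; have := sqnorm_le_lyap (solution sigma) x s.
  by rewrite /solution in xe *; lra.
split=> //; rewrite -mulrA (le_trans _ (cP x))// ler_pM2l//; apply: c1P => l.
by rewrite ffunE; apply: near => i; exact: closest_le.
Qed.

End Coercivity.

(** * Events determined by finite histories *)

Section Probability.
Context {R : realType} {disp : measure_display} {T : measurableType disp}.
Variable P : probability T R.
Implicit Types A B E : set T.

Definition pr A : R := fine (P A).

Lemma prE A : measurable A -> P A = (pr A)%:E.
Proof. by move=> mA; rewrite fineK// fin_num_measure. Qed.

Lemma pr_ge0 A : 0 <= pr A.
Proof. exact: fine_ge0. Qed.

Lemma pr_set0 : pr set0 = 0.
Proof. by rewrite /pr measure0. Qed.

Lemma pr_le A B : measurable A -> measurable B -> A `<=` B -> pr A <= pr B.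
Proof.
move=> mA mB AB; rewrite /pr fine_le ?fin_num_measure//.
by rewrite le_measure ?inE.
Qed.

Lemma pr_setU A B : measurable A -> measurable B -> A `&` B = set0 ->
  pr (A `|` B) = pr A + pr B.
Proof.
by move=> mA mB AB0; rewrite /pr measureU// fineD ?fin_num_measure.
Qed.

Lemma pr_partition (X : finType) (f : T -> X) E : finite_rv f -> measurable E ->
  pr E = \sum_a pr (E `&` f @^-1` [set a]).
Proof.
move=> mf mE; suff part s : uniq s ->
    measurable (E `&` [set w | f w \in s]) /\
    pr (E `&` [set w | f w \in s]) = \sum_(a <- s) pr (E `&` f @^-1` [set a]).
  rewrite -(part (index_enum X) (index_enum_uniq X)).2; congr pr.
  apply/seteqP; split=> w /= => [Ew|[]//]; split=> //; exact: mem_index_enum.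
elim: s => [_|a s IH /=/andP[a_s /IH[ms sE]]].
  rewrite big_nil -pr_set0; have -> : E `&` [set w | f w \in [::]] = set0.
    by apply/seteqP; split=> w [].
  by split=> //; exact: measurable0.
have mEa : measurable (E `&` f @^-1` [set a]) by exact: measurableI.
rewrite big_cons -sE -pr_setU//; last first.
  by apply/seteqP; split=> w //= [[_ ->] [_]]; rewrite (negbTE a_s).
have -> : E `&` [set w | f w \in a :: s] =
    (E `&` f @^-1` [set a]) `|` (E `&` [set w | f w \in s]).
  apply/seteqP; split=> w /=; rewrite inE.
    by move=> [Ew /orP[/eqP|]]; [left|right].
  by move=> [[Ew ->]|[Ew ->]]; split=> //; rewrite ?eqxx ?orbT.
by split=> //; exact: measurableU.
Qed.

Lemma pr_bigcap_ge (E : nat -> set T) c : (forall k, measurable (E k)) ->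
  {homo E : j k / (j <= k)%N >-> k `<=` j} -> (forall k, c <= pr (E k)) ->
  c <= pr (\bigcap_k E k).
Proof.
move=> mE decE cE; have mI : measurable (\bigcap_k E k).
  exact: bigcap_measurable.
have cvgE : P \o E @ \oo --> (pr (\bigcap_k E k))%:E.
  rewrite -prE//; apply: nonincreasing_cvg_mu => //.
    by rewrite (le_lt_trans (probability_le1 P _))// ltry.
  by move=> j k jk; apply/subsetPset; exact: decE.
have : (fun k => pr (E k)) @ \oo --> pr (\bigcap_k E k) by exact: fine_cvg cvgE.
by move=> /cvgr_to_ge; apply; near=> k; exact: cE.
Unshelve. all: by end_near. Qed.

Lemma pr_bigcup_le (E : nat -> set T) c : (forall k, measurable (E k)) ->
  {homo E : j k / (j <= k)%N >-> j `<=` k} -> (forall k, pr (E k) <= c) ->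
  pr (\bigcup_k E k) <= c.
Proof.
move=> mE incE cE; have mU : measurable (\bigcup_k E k).
  exact: bigcup_measurable.
have cvgE : P \o E @ \oo --> (pr (\bigcup_k E k))%:E.
  rewrite -prE//; apply: nondecreasing_cvg_mu => //.
  by move=> j k jk; apply/subsetPset; exact: incE.
have : (fun k => pr (E k)) @ \oo --> pr (\bigcup_k E k) by exact: fine_cvg cvgE.
by move=> /cvgr_to_le; apply; near=> k; exact: cE.
Unshelve. all: by end_near. Qed.

Section History.
Context {Z : finType}.
Variables (X : nat -> T -> Z) (X_rv : forall k, finite_rv (X k)).

Definition history k w : seq Z := mkseq (X^~ w) k.

Definition cylinder (h : seq Z) : set T := [set w | history (size h) w = h].

Definition determined k E : Prop :=
  forall w w', history k w = history k w' -> E w -> E w'.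

Lemma historyS k w : history k.+1 w = rcons (history k w) (X k w).
Proof. exact: mkseqS. Qed.

Lemma history_le j k w w' : (j <= k)%N ->
  history k w = history k w' -> history j w = history j w'.
Proof.
move=> jk /(congr1 (take j)); rewrite /history /mkseq -!map_take take_iota.
by rewrite (minn_idPl jk).
Qed.

Lemma determined_le j k E : (j <= k)%N -> determined j E -> determined k E.
Proof. by move=> jk detE w w' /(history_le jk); exact: detE. Qed.

(** Splitting by the last draw leaves events determined one step earlier. *)
Lemma determined_measurable k E : determined k E -> measurable E.
Proof.
elim: k E => [|k IH] E detE.
  have [[w Ew]|noE] := pselect (exists w, E w).
    suff -> : E = setT by exact: measurableT.
    by apply/seteqP; split=> // w' _; exact: detE Ew.
  suff -> : E = set0 by exact: measurable0.
  by apply/seteqP; split=> // w Ew; apply: noE; exists w.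
have -> : E = \bigcup_(z in setT) ((X k @^-1` [set z]) `&`
    [set w | exists2 w', E w' & history k.+1 w' = rcons (history k w) z]).
  apply/seteqP; split=> w /=.
    by move=> Ew; exists (X k w) => //; split=> //; exists w => //; rewrite historyS.
  by move=> [z _ [/= <- [w' Ew']]]; rewrite -historyS => /detE; exact.
apply: fin_bigcup_measurable => [|z _]; first exact: finite_finset.
apply: measurableI; first exact: X_rv.
by apply: IH => w w' ww' [w'' Ew'' ?]; exists w''; rewrite // -ww'.
Qed.

Lemma cylinder_determined h : determined (size h) (cylinder h).
Proof. by move=> w w'; rewrite /cylinder /= => ->. Qed.

Lemma cylinder_measurable h : measurable (cylinder h).
Proof. exact: determined_measurable (@cylinder_determined h). Qed.

Lemma cylinder_nil : cylinder [::] = setT.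
Proof. by apply/seteqP; split. Qed.

Lemma cylinder_rcons h z : cylinder (rcons h z) = cylinder h `&` X (size h) @^-1` [set z].
Proof.
apply/seteqP; split=> w; rewrite /cylinder /= size_rcons historyS.
  by move=> /rcons_inj[].
by move=> [-> ->].
Qed.

Lemma pr_cylinder_partition E h : measurable E ->
  pr (E `&` cylinder h) = \sum_z pr (E `&` cylinder (rcons h z)).
Proof.
move=> mE; rewrite (pr_partition (X_rv (size h))).
  by apply: eq_bigr => z _; rewrite cylinder_rcons setIA.
by apply: measurableI => //; exact: cylinder_measurable.
Qed.

Lemma determined_cylinder E h : determined (size h) E ->
  E `&` cylinder h = cylinder h \/ E `&` cylinder h = set0.
Proof.
move=> detE; have [[w [Ew hw]]|noE] := pselect (exists w, (E `&` cylinder h) w).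
  left; apply/seteqP; split=> [w' []//|w' hw']; split=> //.
  by apply: detE Ew; rewrite hw hw'.
by right; apply/seteqP; split=> // w Ew; apply: noE; exists w.
Qed.

(* If [~` F] had positive probability, it would be well approximated by the   *)
(* determined event [B K J] that every [E k] with [k <= K] has failed by time *)
(* [K + J]; but [F] keeps a fraction [c] of every determined event.           *)
Lemma zero_one (E : nat -> nat -> set T) (c : R) :
  0 < c -> (forall k j, determined (k + j) (E k j)) ->
  (forall k, {homo E k : i j / (i <= j)%N >-> j `<=` i}) ->
  let F := \bigcup_k \bigcap_j E k j in
  (forall h, c * pr (cylinder h) <= pr (F `&` cylinder h)) -> P (~` F) = 0.
Proof.
move=> c_gt0 detE decE F cF.
have mE k j : measurable (E k j) by exact: determined_measurable (detE k j).
have mI k : measurable (\bigcap_j E k j) by exact: bigcap_measurable.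
have mF : measurable F by exact: bigcup_measurable.
(* An event determined at time [k] is a disjoint union of cylinders of length [k]; below, [j] counts
   the draws still to be split. *)
have cB k B : determined k B -> c * pr B <= pr (F `&` B).
  move=> detB; have mB := determined_measurable detB.
  rewrite -[B]setIT -cylinder_nil.
  suff: forall j h, (size h + j = k)%N ->
      c * pr (B `&` cylinder h) <= pr (F `&` (B `&` cylinder h)).
    by move/(_ k [::]); apply.
  elim=> [|j IH] h => [|hk].
    rewrite addn0 => hk; have := @determined_cylinder B h.
    by rewrite hk => /(_ detB)[]->; rewrite ?setI0 ?pr_set0 ?mulr0.
  rewrite pr_cylinder_partition// setIA pr_cylinder_partition; last exact: measurableI.
  rewrite mulr_sumr; apply: ler_sum => z _; rewrite -setIA; apply: IH.
  by rewrite size_rcons addSnnS.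
pose B K J : set T := \bigcap_(k in `I_K.+1) ~` E k J.
have detB K J : determined (K + J) (B K J).
  move=> w w' ww' Bw k kK Ew'; apply: (Bw k kK).
  have kKJ : (k + J <= K + J)%N by rewrite leq_add2r.
  exact: (determined_le kKJ (detE k J)) (esym ww') Ew'.
have mB K J : measurable (B K J) by exact: determined_measurable (detB K J).
pose BI K := \bigcup_J B K J.
have mBI K : measurable (BI K) by exact: bigcup_measurable.
have BI_ge K : ~` F `<=` BI K.
  move=> w Fw; have Ew k : exists j, ~ E k j w.
    by apply: contrapT => /forallNP noE; apply: Fw; exists k => // j _;
    apply: contrapT; exact: noE.
  have [j jP] := choice Ew; exists (\max_(k < K.+1) j k)%N => // k kK Ekw.
  apply: (jP k); apply: decE Ekw.
  exact: (@leq_bigmax _ (fun k : 'I_K.+1 => j k) (Ordinal kK)).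
have decBI : {homo BI : i j / (i <= j)%N >-> j `<=` i}.
  move=> i j ij w [J _ Bw]; exists J => // k ki; apply: Bw.
  exact: leq_trans ki _.
(* A point of [F] stays in all [E k j] for some [k], so it is not in [BI k]. *)
have FBI : \bigcap_K (F `&` BI K) = set0.
  apply/seteqP; split=> // w FB; have [[k _ Ekw] _] := FB 0%N I.
  have [_ [J _ Bw]] := FB k I; apply: (Bw k) => /=; first exact: ltnSn.
  exact: Ekw.
have cBI K : c * pr (~` F) <= pr (F `&` BI K).
  apply: (@le_trans _ _ (c * pr (BI K))).
    by rewrite ler_pM2l// pr_le//; exact: measurableC.
  rewrite mulrC -ler_pdivlMr//; apply: pr_bigcup_le => // [i j ij w Bw k kK Ew|J].
    by apply: (Bw k kK); exact: decE Ew.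
  rewrite ler_pdivlMr// mulrC (le_trans (cB _ _ (detB K J)))// pr_le//.
  - exact: measurableI.
  - exact: measurableI.
  by apply: setIS => w Bw; exists J.
have : c * pr (~` F) <= pr (\bigcap_K (F `&` BI K)).
  apply: pr_bigcap_ge => // [K|i j ij]; first exact: measurableI.
  by apply: setIS; exact: decBI.
rewrite FBI pr_set0 pmulr_rle0// => F0.
rewrite prE; last exact: measurableC.
by congr EFin; apply/eqP; rewrite eq_le F0 pr_ge0.
Qed.

End History.
End Probability.

(** * Convergence of the process *)

Section Dynamics.
Context {R : realType} {n d m : nat}.
Variables (M : 'M[R]_(m, d)) (b : 'cV[R]_m) (xstar : 'I_n.+1 -> 'cV[R]_d).
Hypothesis M_nonzero_rows : forall l, row l M != 0.
Hypothesis uniqueness : unique_up_to_relabeling M b xstar.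
Hypothesis xstar_covers : forall l, exists i, misfit M b l (xstar i) = 0.
Variables (D : 'I_m -> R) (D_pos : forall l, 0 < D l) (D_sum1 : \sum_l D l = 1).
Variable x0 : 'I_n.+1 -> 'cV[R]_d.
Local Notation Z := ('I_m * 'I_n.+1)%type.
Local Notation solution := (solution xstar).
Local Notation update := (update M b).
Local Notation mean_gain := (mean_gain M b D).

Definition state (h : seq Z) := foldl (fun x z => update z.1 z.2 x) x0 h.

Lemma state_rcons h z : state (rcons h z) = update z.1 z.2 (state h).
Proof. by rewrite /state foldl_rcons. Qed.

Lemma lyap_state_bounded y : exists V0, forall h, lyap y (state h) <= V0.
Proof.
have [K [R0 [K0 KR0 Kproj]]] := relaxed_proj_bounded (dot_psd d) (fun l => b l 0)
  (normal_gt0 M_nonzero_rows) (\sum_i sqnorm (x0 i)).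
exists (\sum_i (2 * R0 + 2 * sqnorm (- y i))) => h.
have Kh i : K (state h i).
  elim/last_ind: h i => [|h z IH] i.
    apply: K0; rewrite (bigD1 i)//= lerDl sumr_ge0// => j _; exact: sqnorm_ge0.
  rewrite state_rcons.
  have [a a01 ->] := update_relaxed_proj M b z.1 z.2 (state h) i.
  exact: Kproj.
apply: ler_sum => i _; apply: le_trans (sqnormD_le _ _) _.
by rewrite lerD2r ler_pM2l// KR0.
Qed.

Lemma lyap_cvg y (x : nat -> 'I_n.+1 -> 'cV[R]_d) (e rho : R) k0 : 0 <= rho < 1 ->
  (forall i, lyap y (x (k0 + i)%N) <= e * rho ^+ i) ->
  forall i, (fun k => x k i) @ \oo --> y i.
Proof.
move=> /andP[rho0 rho1] xP i; rewrite -(cvg_shiftn k0); apply/cvgrPdist_le => eps eps_gt0.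
have geo : geometric e rho @ \oo --> 0 by apply: cvg_geometric; rewrite ger0_norm.
have small : \forall j \near \oo, e * rho ^+ j <= eps ^+ 2.
  by apply: (cvgr_le _ geo); rewrite exprn_gt0.
near=> j.
rewrite /Num.norm/= mx_normrE; apply: bigmax_le => [|[a c] _ /=]; first exact: ltW.
rewrite -ler_sqr ?nnegrE ?(ltW eps_gt0)// real_normK ?num_real//.
apply: (@le_trans _ _ (e * rho ^+ j)); last by near: j.
apply: le_trans (xP j).
apply: le_trans (sqnorm_le_lyap _ _ i).
rewrite addnC -sqnormN opprB (ord1 c).
exact: sqnorm_ge_entry.
Unshelve. all: by end_near. Qed.

Section Run.
Context {disp : measure_display} {T : measurableType disp} (P : probability T R).
Variables (X : nat -> T -> Z) (X_rv : forall k, finite_rv (X k)).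
Variable r : R.
Hypothesis r_gt0 : 0 < r.
Local Notation cylinder := (cylinder X).
Local Notation history := (history X).
Local Notation weight h := (pr P (cylinder h)).

(** These three conditions are conditional probabilities given a history, multiplied out by its
    weight, and are all that the convergence argument uses of the law of the draws. *)
Hypothesis weight_row : forall h l,
  \sum_t weight (rcons h (l, t)) = weight h * D l.
Hypothesis weight_step : forall h l t,
  weight h * D l * (r / n.+1%:R) <= weight (rcons h (l, t)).
Hypothesis weight_swap : forall h l,
  \sum_(t | `[< ~ is_argmin M b l (state h) t >]) weight (rcons h (l, t)) <=
  weight h * D l * r.

Section Drift.
Variables (sigma : 'S_n.+1) (e c : R).
Local Notation V h := (lyap (solution sigma) (state h)).
Hypothesis near_argmin : forall x, lyap (solution sigma) x <= e ->
  (forall l s, is_argmin M b l x s -> misfit M b l (solution sigma s) = 0) /\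
  c * lyap (solution sigma) x <= mean_gain x.

(** A target attaining the minimum has its solution on the sampled hyperplane and gains; the other
    targets have conditional probability at most [r] and at worst quadruple the potential. *)
Lemma lyap_drift h : V h <= e ->
  \sum_z weight (rcons h z) * V (rcons h z) <= weight h * ((1 - c + 4 * r) * V h).
Proof.
move=> Vh; have [argminP cV] := near_argmin Vh.
have w_ge0 h' : 0 <= weight h' by exact: pr_ge0.
have Vh0 : 0 <= V h by exact: lyap_ge0.
apply: (@le_trans _ _ (\sum_l weight h * (D l * (V h - gain M b l (state h)) + D l * (4 * r * V h)))).
  have -> : \sum_z weight (rcons h z) * V (rcons h z) =
      \sum_l \sum_t weight (rcons h (l, t)) * V (rcons h (l, t)).
    by rewrite pair_bigA; apply: eq_bigr => -[].
  apply: ler_sum => l _; set g := gain _ _ _ _.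
  have closeP := argminP l _ (@closest_le _ _ _ _ M b l (state h)).
  have gV : g <= V h by exact: gain_le_lyap closeP.
  (* Since [V h - g] is nonnegative, it may be charged to every target, the non-minimizers paying
     [4 * V h] on top. *)
  apply: (@le_trans _ _ (\sum_t (weight (rcons h (l, t)) * (V h - g) +
      (if `[< ~ is_argmin M b l (state h) t >] then weight (rcons h (l, t)) else 0)
        * (4 * V h)))).
    apply: ler_sum => t _; rewrite state_rcons /=.
    case: asboolP => [_|/contrapT/argminP tP].
      have : lyap (solution sigma) (update l t (state h)) <= 4 * V h.
        exact: lyap_update_growth closeP.
      move=> /(ler_wpM2l (w_ge0 (rcons h (l, t)))) h1.
      by rewrite (le_trans h1)// lerDr mulr_ge0// subr_ge0.
    by rewrite mul0r addr0 ler_wpM2l// lyap_update_le.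
  rewrite big_split/= -!mulr_suml weight_row -big_mkcond/= [leRHS]mulrDr [X in _ <= X + _]mulrA lerD2l.
  have := ler_wpM2r (mulr_ge0 (ler0n R 4) Vh0) (weight_swap h l).
  by congr (_ <= _); ring.
rewrite -mulr_sumr ler_wpM2l// big_split/= -mulr_suml D_sum1 mul1r.
under eq_bigr do rewrite mulrBr.
rewrite sumrB -mulr_suml D_sum1 mul1r -/(mean_gain _).
by move: cV; lra.
Qed.

Let rho := 1 - c + 4 * r.
Hypothesis rho_gt0 : 0 < rho.
Hypothesis rho_le1 : rho <= 1.

Definition tube k j (theta : R) : set T :=
  [set w | forall i, (i <= j)%N -> V (history (k + i) w) <= theta * rho ^+ i].

Lemma tube_determined k j theta : determined X (k + j) (tube k j theta).
Proof.
move=> w w' ww' tw i ij; have kij : (k + i <= k + j)%N by rewrite leq_add2l.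
by rewrite -(history_le kij ww'); exact: tw.
Qed.

(* Maximal inequality for the supermartingale [V / rho ^ k]. *)
Lemma pr_tube_ge j h theta : 0 < theta <= e ->
  weight h * (1 - V h / theta) <= pr P (tube (size h) j theta `&` cylinder h).
Proof.
have mtube k i th : measurable (tube k i th).
  exact: (determined_measurable X_rv (@tube_determined k i th)).
have mcyl h' : measurable (cylinder h') by exact: cylinder_measurable.
elim: j h theta => [|j IH] h theta /andP[theta_gt0 theta_e];
  have [Vtheta|Vtheta] := lerP (V h) theta; last 1 first.
- apply: le_trans (pr_ge0 P _); rewrite mulr_ge0_le0 ?pr_ge0// subr_le0.
  by rewrite ler_pdivlMr// mul1r ltW.
- apply: (@le_trans _ _ (weight h)).
    by rewrite ler_piMr ?pr_ge0// lerBlDr lerDl divr_ge0 ?lyap_ge0// ltW.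
  apply: pr_le => //; first exact: measurableI.
  move=> w hw; split=> // i; rewrite leqn0 => /eqP->.
  by rewrite addn0 expr0 mulr1 hw.
- apply: le_trans (pr_ge0 P _); rewrite mulr_ge0_le0 ?pr_ge0// subr_le0.
  by rewrite ler_pdivlMr// mul1r ltW.
rewrite (pr_cylinder_partition P X_rv)//.
have rt0 : 0 < theta * rho by rewrite mulr_gt0.
(* After one draw the rest of the tube is a tube of width [theta * rho], and the drift supplies
   exactly the factor [rho]. *)
apply: (@le_trans _ _ (\sum_z weight (rcons h z) * (1 - V (rcons h z) / (theta * rho)))).
  under eq_bigr do rewrite mulrBr mulr1 mulrA.
  have wE : weight h = \sum_z weight (rcons h z).
    have := pr_cylinder_partition P X_rv h measurableT.
    by rewrite setTI => ->; under eq_bigr do rewrite setTI.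
  rewrite sumrB -wE -mulr_suml mulrBr mulr1 lerD2l lerN2 ler_pdivrMr//.
  apply: le_trans (lyap_drift (le_trans Vtheta theta_e)) _.
  rewrite le_eqVlt; apply/orP; left; apply/eqP; rewrite -/rho; field.
  by rewrite gt_eqF.
apply: ler_sum => z _; apply: le_trans (IH _ _ _) _.
  rewrite rt0/= (le_trans _ theta_e)// ler_piMr// ltW//.
apply: pr_le => [| |w [tw hw]]; [exact: measurableI..|].
split=> // -[_|i]; last by rewrite ltnS exprS mulrA -addSnnS -(size_rcons h z); exact: tw.
move: hw; rewrite cylinder_rcons => -[hw _].
by rewrite addn0 expr0 mulr1 hw.
Qed.

End Drift.

Section Convergence.
Variables (e c c' : R).
Hypothesis e_gt0 : 0 < e.
Hypothesis near_solution : forall sigma x, lyap (solution sigma) x <= e ->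
  (forall l s, is_argmin M b l x s -> misfit M b l (solution sigma s) = 0) /\
  c * lyap (solution sigma) x <= mean_gain x.
Hypothesis c'_gt0 : 0 < c'.
Hypothesis away_solution : forall x,
  (forall sigma, e / 2 <= lyap (solution sigma) x) -> c' <= mean_gain x.
Let rho := 1 - c + 4 * r.
Hypothesis rho_gt0 : 0 < rho.
Hypothesis rho_lt1 : rho < 1.

(** The relabeling may vary with [j], which keeps the event determined at time [k + j]. *)
Let some_tube k j : set T := [set w | exists sigma, tube sigma c k j e w].
Let trapped := \bigcup_k \bigcap_j some_tube k j.

Let some_tube_determined k j : determined X (k + j) (some_tube k j).
Proof.
by move=> w w' ww' [sigma tw]; exists sigma; exact: tube_determined ww' tw.
Qed.

Let some_tube_dec k : {homo some_tube k : i j / (i <= j)%N >-> j `<=` i}.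
Proof.
move=> i j ij w [sigma tw]; exists sigma => a ai; apply: tw.
exact: leq_trans ai ij.
Qed.

Let some_tube_measurable k j : measurable (some_tube k j).
Proof. exact: (determined_measurable X_rv (@some_tube_determined k j)). Qed.

Let trapped_measurable : measurable trapped.
Proof. by apply: bigcup_measurable => k _; exact: bigcapT_measurable. Qed.

Let cylinder_measurable h : measurable (cylinder h).
Proof. exact: cylinder_measurable. Qed.

(** The maximal inequality for a tube of width [e], twice the starting bound. *)
Let trapped_near h sigma : lyap (solution sigma) (state h) <= e / 2 ->
  2^-1 * weight h <= pr P (trapped `&` cylinder h).
Proof.
move=> Vh; apply: (@le_trans _ _ (pr P (\bigcap_j (some_tube (size h) j `&` cylinder h)))).
  apply: pr_bigcap_ge => [j|i j ij|j]; first exact: measurableI.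
    by apply: setSI; exact: some_tube_dec.
  have ee : 0 < e <= e by rewrite e_gt0 lexx.
  have := pr_tube_ge (@near_solution sigma) rho_gt0 (ltW rho_lt1) j h ee.
  move=> /(le_trans _)/le_trans; apply.
    rewrite mulrC ler_wpM2l ?pr_ge0//.
    have : lyap (solution sigma) (state h) / e <= 2^-1.
      by rewrite ler_pdivrMr// mulrC.
    by lra.
  apply: pr_le => [| |w [tw hw]]; [|exact: measurableI|by split=> //; exists sigma].
  apply: measurableI => //.
  exact: (determined_measurable X_rv (@tube_determined sigma c (size h) j e)).
apply: pr_le; [|exact: measurableI|].
  by apply: bigcapT_measurable => j; exact: measurableI.
move=> w tw; split; last by have [] := tw 0%N I.
by exists (size h) => // j _; have [] := tw j I.
Qed.

(** The distance to the fixed labelling [xstar] serves as fuel. Far from every relabeling some row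
    has gain at least [c'], and drawing it with a target whose solution it contains burns [c']. Fuel
    is bounded for all histories, so within a fixed number of such draws the state is near some
    relabeling, not necessarily [xstar]. *)
Let trapped_charged : exists2 p, 0 < p &
  forall h, p * weight h <= pr P (trapped `&` cylinder h).
Proof.
have [l a a' /andP[_ a'a] aD|l|a a_gt0 aD] :=
  uniform_pos (I := 'I_m) (Q := fun l a => a <= D l).
- exact: le_trans aD.
- by exists (D l).
(* The cap at 1 makes the bound with [eta ^+ N] hold also when the state is near a relabeling before
   the fuel is spent. *)
pose eta := Num.min 1 (a * (r / n.+1%:R)).
have eta_gt0 : 0 < eta by rewrite lt_min ltr01 !mulr_gt0 ?invr_gt0.
have eta_le1 : eta <= 1 by rewrite ge_min lexx.
have [V0 V0P] := lyap_state_bounded xstar.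
suff step N h : lyap xstar (state h) <= N%:R * c' ->
    eta ^+ N / 2 * weight h <= pr P (trapped `&` cylinder h).
  exists (eta ^+ Num.bound `|V0 / c'| / 2) => [|h].
    by rewrite divr_gt0 ?exprn_gt0.
  apply: step; rewrite (le_trans (V0P h))// -ler_pdivrMr//.
  exact/ltW/(le_lt_trans (ler_norm _))/archi_boundP/normr_ge0.
have progress x : (forall sigma, e / 2 <= lyap (solution sigma) x) ->
    exists l t, misfit M b l (xstar t) = 0 /\ c' <= gain M b l x.
  move=> /away_solution c'x.
  have [l gl] : exists l, c' <= gain M b l x.
    apply: contrapT => /forallNP small; move: c'x; apply/negP; rewrite -ltNge.
    have gap_gt0 l : 0 < D l * (c' - gain M b l x).
      by rewrite mulr_gt0// subr_gt0 ltNge; exact/negP/small.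
    have -> : mean_gain x = c' - \sum_l D l * (c' - gain M b l x).
      under eq_bigr do rewrite mulrBr.
      by rewrite sumrB -mulr_suml D_sum1 mul1r opprB addrC subrK.
    rewrite ltrBlDr ltrDl lt_def sumr_ge0 ?andbT => [|l _]; last exact: ltW.
    rewrite psumr_eq0 => [|l _]; last exact: ltW.
    apply/negP => /allP gap0; have := D_sum1.
    rewrite big1 => [/esym/eqP|l _]; first by rewrite oner_eq0.
    by have := gap0 l (mem_index_enum _); rewrite /= gt_eqF.
  by have [t lt0] := xstar_covers l; exists l, t.
elim: N h => [|N IH] h VN;
  have [[sigma Vh]|far] := pselect
    (exists sigma, lyap (solution sigma) (state h) <= e / 2).
- by rewrite expr0 mul1r; exact: trapped_near Vh.
- have [sigma|l [t [lt0 gl]]] := progress (state h).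
    by rewrite leNgt; apply/negP => /ltW Vh; apply: far; exists sigma.
  (* Without fuel the state is at [xstar], where no gain is possible. *)
  have := le_trans gl (gain_le_lyap M_nonzero_rows (state h) lt0).
  by move=> /le_trans/(_ VN); rewrite mul0r leNgt c'_gt0.
- apply: le_trans (trapped_near Vh); rewrite ler_wpM2r ?pr_ge0//.
  by rewrite ler_piMl// exprn_ile1// ltW.
have [sigma|l [t [lt0 gl]]] := progress (state h).
  by rewrite leNgt; apply/negP => /ltW Vh; apply: far; exists sigma.
set h' := rcons h (l, t).
have Vh' : lyap xstar (state h') <= N%:R * c'.
  rewrite /h' state_rcons /=.
  apply: le_trans (lyap_update_le M_nonzero_rows _ lt0) _.
  by move: VN; rewrite -natr1 mulrDl mul1r; lra.
apply: (@le_trans _ _ (pr P (trapped `&` cylinder h'))); last first.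
  apply: pr_le; [exact: measurableI..|].
  by apply: setIS; rewrite cylinder_rcons => w [].
apply: le_trans (IH _ Vh'); rewrite exprSr -!mulrA ler_pM2l ?exprn_gt0//.
rewrite mulrCA ler_pM2l ?invr_gt0// mulrC.
apply: le_trans (weight_step h l t); rewrite -mulrA ler_wpM2l ?pr_ge0//.
rewrite /eta ge_min; apply/orP; right.
by rewrite ler_wpM2r ?aD// divr_ge0// ltW.
Qed.

Lemma run_cvg : {ae P, forall w, exists sigma : 'S_n.+1, forall i : 'I_n.+1,
  (fun k => state (history k w) i) @ \oo --> solution sigma i}.
Proof.
have [p p_gt0 pP] := trapped_charged.
exists (~` trapped); split; first exact: measurableC.
  by apply: (zero_one X_rv p_gt0 some_tube_determined some_tube_dec); exact: pP.
apply: subsetC => w [k _ wk] /=.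
(* Tubes shrink with [j] and there are finitely many permutations, so one permutation works for all
   [j]. *)
have [sigma sigmaP] : exists sigma, forall j, tube sigma c k j e w.
  apply: contrapT => /forallNP no_sigma.
  have /choice[j jP] sigma : exists j, ~ tube sigma c k j e w.
    by apply: contrapT => /forallNP all_j; apply: (no_sigma sigma) => j;
      apply: contrapT; exact: all_j.
  have [sigma tw] := wk (\max_s j s)%N I; apply: (jP sigma) => i ij.
  by apply: tw; apply: leq_trans ij _; exact: leq_bigmax.
exists sigma; apply: (@lyap_cvg _ _ e rho k); first by rewrite ltW.
by move=> i; exact: (sigmaP i i (leqnn i)).
Qed.

End Convergence.
End Run.
End Dynamics.

(** * From the random choices of the algorithm to the law of the draws *)

Section FiniteVariables.
Context {R : realType} {disp : measure_display} {T : measurableType disp}.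
Variable P : probability T R.

Lemma finite_rv_measurable (A : finType) (X : T -> A) (S : set A) :
  finite_rv X -> measurable (X @^-1` S).
Proof.
move=> mX; have -> : X @^-1` S = \bigcup_(a in S) X @^-1` [set a].
  apply/seteqP; split=> [w Sw|w [a Sa /= wa]]; first by exists (X w).
  by rewrite /= wa.
by apply: fin_bigcup_measurable => [|a _]; [exact: finite_finset|exact: mX].
Qed.

Lemma finite_rv_pair (A B : finType) (X : T -> A) (Y : T -> B) :
  finite_rv X -> finite_rv Y -> finite_rv (fun w => (X w, Y w)).
Proof.
move=> mX mY [a b]; have -> : (fun w => (X w, Y w)) @^-1` [set (a, b)] =
    X @^-1` [set a] `&` Y @^-1` [set b].
  by apply/seteqP; split=> w /= [-> ->].
exact: measurableI.
Qed.

Lemma pr_preimage (A : finType) (X : T -> A) (S : set A) E :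
  finite_rv X -> measurable E ->
  pr P (E `&` X @^-1` S) = \sum_(a | `[< S a >]) pr P (E `&` X @^-1` [set a]).
Proof.
move=> mX mE; rewrite (pr_partition P mX); last first.
  by apply: measurableI => //; exact: finite_rv_measurable.
rewrite [RHS]big_mkcond; apply: eq_bigr => a _; case: asboolP => Sa.
  congr pr; apply/seteqP; split=> w /=; first by move=> [[]].
  by move=> [Ew Xa]; rewrite Xa.
rewrite -(pr_set0 P); congr pr; apply/seteqP; split=> // w [[_ /= +] Xa].
by rewrite Xa.
Qed.

Lemma independent_preimage (A B : finType) (X : T -> A) (Y : T -> B)
    (S : set A) (S' : set B) :
  finite_rv X -> finite_rv Y -> independent_rv P X Y ->
  pr P (X @^-1` S `&` Y @^-1` S') = pr P (X @^-1` S) * pr P (Y @^-1` S').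
Proof.
move=> mX mY XY; have pX := pr_preimage S mX measurableT.
have pY := pr_preimage S' mY measurableT.
have mS := finite_rv_measurable S mX.
rewrite !setTI in pX pY; rewrite pX pY (pr_preimage S' mY mS) mulr_sumr.
apply: eq_bigr => b _; rewrite setIC (pr_preimage S mX (mY b)) setTI mulr_suml.
apply: eq_bigr => a _; rewrite setTI setIC.
rewrite /pr XY fineM ?fin_num_measure//; exact: mX.
Qed.

End FiniteVariables.

Section Algorithm.
Context {R : realType} {n d m : nat}.
Context {disp : measure_display} {T : measurableType disp} (P : probability T R).
Variables (M : 'M[R]_(m, d)) (b : 'cV[R]_m) (D : 'I_m -> R) (r : R).
Variables (x0 : 'I_n.+1 -> 'cV[R]_d) (row_ : nat -> T -> 'I_m).
Variables (s : nat -> T -> 'I_n.+1) (swap : nat -> T -> bool).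
Variables (u : nat -> T -> 'I_n.+1).
Hypothesis run : mrk_run P row_ s swap u M b D r x0.
Local Notation Z := ('I_m * 'I_n.+1)%type.

(** The iterates depend on the minimizer, the coin and the uniform index only through the target. *)
Definition draw k w : Z := (row_ k w, target s swap u k w).

Local Notation cylinder := (cylinder draw).
Local Notation past := (past row_ s swap u).
Local Notation weight h := (pr P (cylinder h)).

Lemma mrk_process_state k w :
  mrk_process row_ s swap u M b x0 k w = state M b x0 (history draw k w).
Proof.
elim: k => // k IH; rewrite historyS state_rcons -IH /=.
by apply: update_argmin; exact: (run_argmin run k w).
Qed.

Let past_rv k : finite_rv (past k).
Proof.
move=> f; have -> : past k @^-1` [set f] = \bigcap_(j in [set: 'I_k])
    (fun w => (row_ j w, s j w, swap j w, u j w)) @^-1` [set f j].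
  apply/seteqP; split=> w /=; first by move=> <- j _; rewrite ffunE.
  by move=> fw; apply/ffunP => j; rewrite ffunE; exact: fw.
apply: fin_bigcap_measurable => [|j _]; first exact: finite_finset.
apply: finite_rv_pair; last exact: (run_u_rv run j).
apply: finite_rv_pair; last exact: (run_swap_rv run j).
by apply: finite_rv_pair; [exact: (run_row_rv run j)|exact: run_s_rv run j].
Qed.

Lemma draw_rv k : finite_rv (draw k).
Proof.
have -> : draw k = (fun z : 'I_m * bool * ('I_n.+1 * 'I_n.+1) =>
    (z.1.1, if z.1.2 then z.2.1 else z.2.2)) \o
    (fun w => (row_ k w, swap k w, (u k w, s k w))) by [].
move=> z; rewrite comp_preimage; apply: finite_rv_measurable.
by do !apply: finite_rv_pair; [exact: run_row_rv run k|exact: run_swap_rv run k|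
  exact: run_u_rv run k|exact: run_s_rv run k].
Qed.

Let past_history k w w' : past k w = past k w' -> history draw k w = history draw k w'.
Proof.
move=> ww'; apply/eq_in_map => j; rewrite mem_iota /= add0n => jk.
move/ffunP/(_ (Ordinal jk)): ww'; rewrite !ffunE /= => -[e1 e2 e3 e4].
by rewrite /draw /target e1 e2 e3 e4.
Qed.

(** Independence is given relative to [past], which is finer than the history of draws. *)
Let cylinder_past h :
  cylinder h = past (size h) @^-1` (past (size h) @` cylinder h).
Proof.
apply/seteqP; split=> w; first by move=> hw; exists w.
by move=> [w' hw' /past_history ww']; rewrite /cylinder /= -ww'.
Qed.

Let pr_cylinder_row h l :
  pr P (cylinder h `&` row_ (size h) @^-1` [set l]) = weight h * D l.
Proof.
rewrite setIC cylinder_past independent_preimage//.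
- by rewrite mulrC {2}/pr (run_row_law run).
- exact: (run_row_rv run _).
- exact: (run_row_indep run).
Qed.

Let weight_fresh h l (S : set (bool * 'I_n.+1)) :
  pr P (cylinder h `&` row_ (size h) @^-1` [set l] `&`
        (fun w => (swap (size h) w, u (size h) w)) @^-1` S) =
  weight h * D l * pr P ((fun w => (swap (size h) w, u (size h) w)) @^-1` S).
Proof.
set k := size h; rewrite -pr_cylinder_row -/k.
pose S' : set ({ffun 'I_k -> 'I_m * 'I_n.+1 * bool * 'I_n.+1} * 'I_m * 'I_n.+1) :=
  [set q | (past k @` cylinder h) q.1.1 /\ q.1.2 = l].
have -> : cylinder h `&` row_ k @^-1` [set l] =
    (fun w => (past k w, row_ k w, s k w)) @^-1` S'.
  by rewrite cylinder_past.
rewrite setIC independent_preimage 1?mulrC//.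
- by apply: finite_rv_pair; [exact: (run_swap_rv run _)|exact: run_u_rv run _].
- apply: finite_rv_pair; last exact: (run_s_rv run _).
  by apply: finite_rv_pair => //; exact: (run_row_rv run _).
- exact: (run_fresh run).
Qed.

Let mcylinder h : measurable (cylinder h).
Proof. exact: cylinder_measurable draw_rv h. Qed.

Let mcylinder_row h l : measurable (cylinder h `&` row_ (size h) @^-1` [set l]).
Proof. by apply: measurableI => //; exact: (run_row_rv run _) _. Qed.

Let target_rv k : finite_rv (target s swap u k).
Proof.
move=> t; have := finite_rv_measurable [set z | z.2 = t] (@draw_rv k).
by congr measurable.
Qed.

Let cylinder_rconsE h l t : cylinder (rcons h (l, t)) =
  cylinder h `&` row_ (size h) @^-1` [set l] `&` target s swap u (size h) @^-1` [set t].
Proof.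
rewrite cylinder_rcons -setIA; congr (_ `&` _).
by apply/seteqP; split=> w /=; [move=> [-> ->]|move=> [<- <-]].
Qed.

Lemma weight_row h l : \sum_t weight (rcons h (l, t)) = weight h * D l.
Proof.
rewrite -pr_cylinder_row (pr_partition P (@target_rv (size h)))//.
by apply: eq_bigr => t _; rewrite cylinder_rconsE.
Qed.

Let pr_swap k : pr P (swap k @^-1` [set true]) = r.
Proof. by rewrite /pr (run_swap_law run). Qed.

Lemma weight_step h l t :
  weight h * D l * (r / n.+1%:R) <= weight (rcons h (l, t)).
Proof.
set k := size h; have -> : r / n.+1%:R =
    pr P ((fun w => (swap k w, u k w)) @^-1` [set (true, t)]).
  have -> : (fun w => (swap k w, u k w)) @^-1` [set (true, t)] =
      swap k @^-1` [set true] `&` u k @^-1` [set t].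
    by apply/seteqP; split=> w /= [-> ->].
  by rewrite /pr (run_swap_u_indep run) (run_swap_law run) (run_u_law run).
rewrite -weight_fresh; apply: pr_le => //.
  apply: measurableI => //; apply: finite_rv_measurable.
  by apply: finite_rv_pair; [exact: (run_swap_rv run _)|exact: run_u_rv run _].
move=> w; rewrite cylinder_rconsE => -[hw [sw uw]]; split=> //.
by rewrite /target /= sw.
Qed.

(** Without a swap the target is the selected minimizer, so a target that is not a minimizer reveals
    the coin. *)
Lemma weight_swap h l :
  \sum_(t | `[< ~ is_argmin M b l (state M b x0 h) t >]) weight (rcons h (l, t)) <=
  weight h * D l * r.
Proof.
set k := size h; under eq_bigr do rewrite cylinder_rconsE -/k.
rewrite -(pr_preimage _ [set t | ~ is_argmin M b l (state M b x0 h) t] (@target_rv k))//.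
have -> : r = pr P ((fun w => (swap k w, u k w)) @^-1` [set z | z.1 = true]).
  by rewrite -(pr_swap k).
rewrite -weight_fresh; apply: pr_le.
- by apply: measurableI => //; exact: finite_rv_measurable.
- apply: measurableI => //; apply: finite_rv_measurable.
  by apply: finite_rv_pair; [exact: (run_swap_rv run _)|exact: run_u_rv run _].
move=> w [[hw lw] /= not_argmin]; split=> //=.
apply: contra_notT not_argmin => /negbTE noswap; rewrite /target noswap.
have := run_argmin run k w; rewrite mrk_process_state.
by rewrite (hw : history _ _ _ = _) (lw : row_ _ _ = _).
Qed.

End Algorithm.

Theorem theorem2 (R : realType) (n d : nat) (d_ge1 : (1 <= d)%N)
  (q : 'I_n.+1 -> nat)
  (Msub : forall i, 'M[R]_(q i, d)) (bsub : forall i, 'cV[R]_(q i))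
  (xstar : 'I_n.+1 -> 'cV[R]_d)
  (consistent : forall i, Msub i *m xstar i = bsub i)
  (p : 'S_(\sum_i q i))
  (M : 'M[R]_(\sum_i q i, d)) (M_def : M = stacked p Msub)
  (b : 'cV[R]_(\sum_i q i)) (b_def : b = stacked p bsub)
  (M_nonzero_rows : forall l, row l M != 0)
  (uniqueness : unique_up_to_relabeling M b xstar)
  (D : 'I_(\sum_i q i) -> R)
  (D_pos : forall l, 0 < D l) (D_sum1 : \sum_l D l = 1) :
  exists r' : R, 0 < r' < 1 /\
    forall r : R, 0 < r < r' ->
    forall (x0 : 'I_n.+1 -> 'cV[R]_d)
      (disp : measure_display) (T : measurableType disp) (P : probability T R)
      (row_ : nat -> T -> 'I_(\sum_i q i)) (s : nat -> T -> 'I_n.+1)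
      (swap : nat -> T -> bool) (u : nat -> T -> 'I_n.+1),
      mrk_run P row_ s swap u M b D r x0 ->
      {ae P, forall w, exists sigma : 'S_n.+1, forall i : 'I_n.+1,
        (fun k => mrk_process row_ s swap u M b x0 k w i) @ \oo
          --> xstar (sigma i)}.
Proof.
have xstar_covers l : exists i, misfit M b l (xstar i) = 0.
  exists (tagnat.sig1 (p l)); apply/eqP; rewrite subr_eq0 -row_mulmxE M_def b_def.
  have -> : row l (stacked p Msub) =
      row (tagnat.sig2 (p l)) (Msub (tagnat.sig1 (p l))).
    by apply/rowP => j; rewrite !mxE.
  by rewrite -row_mul consistent !mxE.
have [e e_gt0 [c c_gt0 near]] :=
  mean_gain_near M_nonzero_rows uniqueness D_pos xstar_covers.
have e2_gt0 : 0 < e / 2 by rewrite divr_gt0.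
have [c' c'_gt0 away] := mean_gain_away M_nonzero_rows uniqueness D_pos e2_gt0.
(* The cap at 1 keeps [1 - k + 4 * r] positive, and [r] below [k / 8] keeps it below 1. *)
pose k := Num.min c 1.
have k_gt0 : 0 < k by rewrite lt_min c_gt0 ltr01.
have k_le1 : k <= 1 by rewrite ge_min lexx orbT.
have k_lec : k <= c by rewrite ge_min lexx.
exists (k / 4 / 2); split; first by apply/andP; split; lra.
move=> r /andP[r_gt0 r_lt] x0 disp T P row_ s swap u run.
have rho_gt0 : 0 < 1 - k + 4 * r by lra.
have rho_lt1 : 1 - k + 4 * r < 1 by lra.
have near_k sigma x : lyap (solution xstar sigma) x <= e ->
  (forall l s, is_argmin M b l x s -> misfit M b l (solution xstar sigma s) = 0) /\
  k * lyap (solution xstar sigma) x <= mean_gain M b D x.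
  move=> /near[argminP cV]; split=> //; apply: le_trans cV.
  by rewrite ler_wpM2r ?lyap_ge0.
have := run_cvg M_nonzero_rows xstar_covers D_pos D_sum1 (draw_rv run) r_gt0
  (weight_row run) (weight_step run) (weight_swap run) e_gt0 near_k c'_gt0 away
  rho_gt0 rho_lt1.
apply: filterS => w [sigma sigmaP]; exists sigma => i.
by under eq_fun do rewrite (mrk_process_state run); exact: sigmaP.
Qed.
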